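(* Let $\Omega\subset\mathbb{R}^n$ be a bounded $C^2$ domain, $\lambda\ge 0$, $T>0$, let $0\le f\in C^{\alpha}(\overline{\Omega})$ for some $0<\alpha<1$ with $f\not\equiv 0$, and let $0<g\in C^2((-\infty,1))$ satisfy $g'(s)\le 0$ for all $s<1$. Let $u_{0,1},u_{0,2}\in L^{\infty}(\Omega)$ be such that $u_{0,1}\le u_{0,2}\le a<1$ in $\Omega$ for some constant $0<a<1$ and $u_{0,1}\not\equiv u_{0,2}$. Suppose $u_1$, $u_2$ are bounded solutions of (P) in $\Omega\times(0,T)$ with initial values $u_{0,1}$, $u_{0,2}$ respectively. Then $$u_1<u_2\quad\text{in }\Omega\times(0,T).$$
   Context: (P) denotes the problem $u_t=\Delta u+\lambda f(x)/g(u)$ in $\Omega\times(0,T)$, $u=0$ on $\partial\Omega\times(0,T)$, $u(x,0)=u_0$ in $\Omega$. A solution of (P) in $\Omega\times(0,T)$ with initial value $u_0$ is a function $u\in C^{2,1}(\Omega\times(0,T))\cap C(\overline{\Omega}\times(0,T))$ satisfying the equation, $u=0$ on $\partial\Omega\times(0,T)$, $\sup_{\overline{\Omega}\times(0,T']}u<1$ for all $0<T'<T$, and $\|u(\cdot,t)-u_0\|_{L^1(\Omega)}\to 0$ as $t\to 0$. ''$u_{0,1}\not\equiv u_{0,2}$'' means they differ on a set of positive measure. *)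

(* Defs.v *)
From HB Require Import structures.
From mathcomp Require Import all_boot all_order all_algebra.
From mathcomp Require Import all_classical all_reals all_analysis measurable_realfun.
Import Order.TTheory GRing.Theory Num.Theory.
Import numFieldNormedType.Exports.

Set Implicit Arguments.
Unset Strict Implicit.
Unset Printing Implicit Defensive.

Local Open Scope classical_set_scope.
Local Open Scope ring_scope.

(* R^n is 'rV[R]_n. The library norm on it is the max norm; being equivalent
   to the Euclidean norm, it yields the same open and bounded sets, limits and
   Hoelder functions. *)

Section borel.
Context (R : realType) (n : nat).

HB.instance Definition _ := @isMeasurable.Build
  (sigma_display (@open 'rV[R]_n)) 'rV[R]_n <<s (@open 'rV[R]_n) >>
  (@sigma_algebra0 _ setT _) (@sigma_algebraC _ _)
  (@sigma_algebra_bigcup _ setT _).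

Lemma open_measurable_rV (A : set 'rV[R]_n) : open A -> measurable A.
Proof. exact: sub_sigma_algebra. Qed.

Lemma continuous_measurable_rV (f : 'rV[R]_n -> R) :
  continuous f -> measurable_fun setT f.
Proof.
move=> /continuousP cf.
apply: (measurability _ (RGenOpens.measurableE R)).
move=> _ [_ [a [b ->] <-]]; rewrite setTI.
by apply: open_measurable_rV; apply: cf; exact: interval_open.
Qed.

Lemma measurable_fun_rV d (T : measurableType d) (f : T -> 'rV[R]_n) :
  (forall i, measurable_fun setT (fun x => f x ord0 i)) ->
  measurable_fun setT f.
Proof.
move=> mf; apply: (@measurability _ _ _ _ setT f (@open 'rV[R]_n)) => //.
move=> _ [A oA <-]; rewrite setTI.
pose B (p : 'rV[rat]_n * nat) : set 'rV[R]_n :=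
  ball (map_mx ratr p.1 : 'rV[R]_n) p.2.+1%:R^-1.
have AE : A = \bigcup_p (if `[< B p `<=` A >] then B p else set0).
  apply/seteqP; split => [x Ax|x [p _]]; last by case: asboolP => // + Bx; exact.
  have /nbhs_ballP[e /= e0 eA] : nbhs x A by exact: open_nbhs_nbhs.
  have e20 : 0 < e / 2 by rewrite divr_gt0.
  have /filter_ex[k /= ke] := near_infty_natSinv_lt (PosNum e20).
  have k0 : 0 < k.+1%:R^-1 :> R by rewrite invr_gt0.
  have /choice[q qP] (i : 'I_n) :
      exists q : rat, `|ratr q - x ord0 i| < k.+1%:R^-1 :> R.
    have [q] := rat_in_itvoo (ltr_pwDl k0 (lexx (x ord0 i))).
    rewrite in_itv/= => /andP[q1 q2].
    by exists q; rewrite gtr0_norm ?subr_gt0// ltrBlDr.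
  exists (\row_i q i, k) => //; case: asboolP => [_|nBA]; last first.
    exfalso; apply: nBA => y [_ By]; apply: eA; split => // i j; rewrite (ord1 i).
    have := By ord0 j; rewrite /ball/= !mxE => yj.
    rewrite (splitr e) -(subrKA (ratr (q j))).
    apply: (le_lt_trans (ler_normD _ _)); rewrite ltrD//.
      by rewrite distrC (lt_trans (qP j)).
    exact: lt_trans yj ke.
  by split => // i j; rewrite (ord1 i) /ball/= !mxE; exact: qP.
rewrite AE preimage_bigcup; apply: countable_bigcupT_measurable => // -[q k].
case: asboolP => _; last by rewrite preimage_set0.
have -> : f @^-1` B (q, k) = \bigcap_(i in [set: 'I_n])
    ((fun x => f x ord0 i) @^-1` ball (ratr (q ord0 i) : R) k.+1%:R^-1).
  apply/seteqP; split => [x [_ Bx] i _|x Bx].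
    by have := Bx ord0 i; rewrite !mxE.
  split; first by rewrite /= invr_gt0.
  by move=> i j; rewrite (ord1 i) !mxE; exact: Bx.
apply: fin_bigcap_measurable => // i _.
by rewrite -[X in measurable X]setTI; apply: mf => //; exact: measurable_ball.
Qed.

End borel.

Section lebesgue_step.
Context (R : realType) (n : nat).

Definition cons_rV (p : measurableTypeR R * 'rV[R]_n) : 'rV[R]_n.+1 :=
  row_mx (p.1%:M : 'rV[R]_1) p.2.

Lemma measurable_cons_rV : measurable_fun setT cons_rV.
Proof.
apply: measurable_fun_rV => i; case: (split_ordP (i : 'I_(1 + n))) => j ->.
  rewrite (_ : (fun _ => _) = fst)//; apply/funext => p.
  by apply: (etrans (row_mxEl _ _ _ _)); rewrite (ord1 j) mxE eqxx.
rewrite (_ : (fun _ => _) = (fun y : 'rV[R]_n => y ord0 j) \o snd); last first.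
  by apply/funext => p; exact: row_mxEr.
apply: measurableT_comp => //; apply: continuous_measurable_rV.
exact: coord_continuous.
Qed.

Definition uncons_rV (x : 'rV[R]_n.+1) : measurableTypeR R * 'rV[R]_n :=
  (x ord0 ord0, rsubmx (x : 'rV[R]_(1 + n))).

Lemma measurable_uncons_rV : measurable_fun setT uncons_rV.
Proof.
apply/measurable_fun_pair.
  by apply: continuous_measurable_rV; exact: coord_continuous.
apply: measurable_fun_rV => i.
rewrite (_ : (fun _ => _) =
    fun x : 'rV[R]_n.+1 => x ord0 (rshift 1 i : 'I_(1 + n))); last first.
  by apply/funext => x; rewrite mxE.
by apply: continuous_measurable_rV; exact: coord_continuous.
Qed.

Lemma uncons_rVK : cancel uncons_rV cons_rV.
Proof.
move=> x; apply: etrans (hsubmxK (x : 'rV[R]_(1 + n))).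
apply: (congr1 (fun a => row_mx a _)); apply/rowP => i.
by rewrite (ord1 i) !mxE eqxx mulr1n; congr (x _ _); exact/val_inj.
Qed.

Lemma cons_rVK : cancel cons_rV uncons_rV.
Proof.
move=> [a y]; rewrite /uncons_rV/= /cons_rV row_mxKr; congr pair.
rewrite (_ : ord0 = lshift n (ord0 : 'I_1)); last exact/val_inj.
by apply: (etrans (row_mxEl _ _ _ _)); rewrite mxE eqxx.
Qed.

Variable mu : {sigma_finite_measure set 'rV[R]_n -> \bar R}.

Definition lebesgue_step : set 'rV[R]_n.+1 -> \bar R :=
  pushforward (@lebesgue_measure R \x mu)%E cons_rV.

HB.instance Definition _ := Measure.copy lebesgue_step
  (measure_function_pushforward__canonical__measure_function_Measure
    (@lebesgue_measure R \x mu)%E measurable_cons_rV).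

Let sigma_finite_lebesgue_step : sigma_finite setT lebesgue_step.
Proof.
have /sigma_finiteP[F [FT ndF Foo]] := sigma_finiteT (@lebesgue_measure R).
have /sigma_finiteP[G [GT ndG Goo]] := sigma_finiteT mu.
exists (fun k => uncons_rV @^-1` (F k `*` G k)).
  rewrite -preimage_bigcup (_ : \bigcup_k _ = setT) ?preimage_setT//.
  apply/seteqP; split => // -[a y] _.
  have [k _ Fka] : (\bigcup_k F k) a by rewrite -FT.
  have [l _ Gly] : (\bigcup_k G k) y by rewrite -GT.
  exists (maxn k l) => //; split => /=.
    by move: Fka; exact/subsetPset/ndF/leq_maxl.
  by move: Gly; exact/subsetPset/ndG/leq_maxr.
move=> k; have [mF Fk] := Foo k; have [mG Gk] := Goo k; split.
  rewrite -[X in measurable X]setTI; apply: measurable_uncons_rV => //.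
  exact: measurableX.
rewrite /lebesgue_step /pushforward -comp_preimage.
rewrite (_ : uncons_rV \o cons_rV = id); last first.
  by apply/funext => p; exact: cons_rVK.
by rewrite preimage_id product_measure1E// lte_mul_pinfty// ge0_fin_numE.
Qed.

HB.instance Definition _ := @Measure_isSigmaFinite.Build _ _ _
  lebesgue_step sigma_finite_lebesgue_step.

End lebesgue_step.

(* n-dimensional Lebesgue measure (on Borel sets): the n-fold product of the
   one-dimensional one, carried over to 'rV[R]_n. *)
Fixpoint lebesgue_rV (R : realType) (n : nat) :
    {sigma_finite_measure set 'rV[R]_n -> \bar R} :=
  match n with
  | 0%N => @dirac _ 'rV[R]_0 0 R
  | n'.+1 => lebesgue_step (lebesgue_rV R n')
  end.

Section calculus.
Context (R : realType) (n : nat).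
Implicit Types (i j : 'I_n) (h : 'rV[R]_n -> R) (u : 'rV[R]_n -> R -> R).

Definition e_ i : 'rV[R]_n := delta_mx ord0 i.

Definition partial i h : 'rV[R]_n -> R := fun x => 'D_(e_ i) h x.

Definition laplacian h : 'rV[R]_n -> R :=
  fun x => \sum_(i < n) partial i (partial i h) x.

Definition C2_rV h : Prop :=
  [/\ continuous h,
      forall i, (forall x, derivable h x (e_ i)) /\ continuous (partial i h) &
      forall i j, (forall x, derivable (partial i h) x (e_ j)) /\
        continuous (partial j (partial i h))].

(* f is in C^alpha(D): the bound on f itself need not be required, since D will
   be a compact set. *)
Definition hoelder_on (D : set 'rV[R]_n) (alpha : R) (f : 'rV[R]_n -> R) :=
  exists C : R, forall x y, D x -> D y -> `|f x - f y| <= C * `|x - y| `^ alpha.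

(* On an open set Q of space-time: u, u_t and all the first and second order
   derivatives in space exist and are jointly continuous in (x, t). *)
Definition C21_on (Q : set ('rV[R]_n * R)) u : Prop := forall x t, Q (x, t) ->
  [/\ {for (x, t), continuous (fun p : 'rV[R]_n * R => u p.1 p.2)},
      derivable (u x) t 1 /\
        {for (x, t), continuous (fun p : 'rV[R]_n * R => derive1 (u p.1) p.2)},
      forall i, derivable (u ^~ t) x (e_ i) /\
        {for (x, t), continuous
          (fun p : 'rV[R]_n * R => partial i (u ^~ p.2) p.1)} &
      forall i j, derivable (partial i (u ^~ t)) x (e_ j) /\
        {for (x, t), continuous
          (fun p : 'rV[R]_n * R => partial j (partial i (u ^~ p.2)) p.1)}].

End calculus.

Definition C2_lt1 (R : realType) (g : R -> R) : Prop := forall s, s < 1 ->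
  [/\ derivable g s 1, derivable (derive1 g) s 1 &
      {for s, continuous (derive1 (derive1 g))}].

(* D `&` U is the part of the ball U lying strictly on one side of the graph
   of a C^2 function, after a permutation (choice of the coordinate i) and a
   reorientation (choice of b) of the coordinate axes; col' i x is x without
   its i-th coordinate. *)
Definition C2_boundary (R : realType) (n : nat) (D : set 'rV[R]_n) : Prop :=
  forall x0, (closure D `\` D) x0 ->
  exists (r : R) (i : 'I_n) (b : bool) (gamma : 'rV[R]_n.-1 -> R),
    [/\ 0 < r, C2_rV gamma &
        forall x, ball x0 r x ->
          D x <-> (-1) ^+ b * gamma (col' i x) < (-1) ^+ b * x ord0 i].

Definition bounded_C2_domain (R : realType) (n : nat) (D : set 'rV[R]_n) :=
  [/\ D !=set0, open D, connected D, bounded_set D & C2_boundary D].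

(* Elements of L^oo(D) are functions up to a.e. equality, hence are represented
   by Borel functions. *)
Definition Linfty (R : realType) (n : nat) (D : set 'rV[R]_n)
    (v : 'rV[R]_n -> R) : Prop :=
  measurable_fun D v /\
  exists M : R, {ae lebesgue_rV R n, forall x, D x -> `|v x| <= M}.

Section problem_P.
Context (R : realType) (n : nat) (Omega : set 'rV[R]_n) (lambda : R)
  (f : 'rV[R]_n -> R) (g : R -> R) (T : R).

Definition solution_P (u0 : 'rV[R]_n -> R) (u : 'rV[R]_n -> R -> R) : Prop :=
  [/\ C21_on (Omega `*` `]0, T[) u /\
        {within closure Omega `*` `]0, T[,
          continuous (fun p : 'rV[R]_n * R => u p.1 p.2)},
      forall x t, Omega x -> 0 < t < T ->
        derive1 (u x) t = laplacian (u ^~ t) x + lambda * f x / g (u x t),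
      forall x t, (closure Omega `\` Omega) x -> 0 < t < T -> u x t = 0,
      forall T', 0 < T' < T ->
        (ereal_sup [set (u p.1 p.2)%:E | p in closure Omega `*` `]0%R, T']]
           < 1)%E &
      (\int[lebesgue_rV R n]_(x in Omega) (`|u x t - u0 x|)%:E)%E
        @[t --> 0^'+] --> 0%E].

Definition bounded_on_cylinder (u : 'rV[R]_n -> R -> R) : Prop :=
  exists M : R, forall x t, Omega x -> 0 < t < T -> `|u x t| <= M.

End problem_P.

(* Main.v *)
Require Import Defs.
From mathcomp Require Import all_boot all_order all_algebra.
From mathcomp Require Import all_classical all_reals all_analysis.
From mathcomp Require Import measurable_realfun ring lra.
Import Order.TTheory GRing.Theory Num.Theory.
Import numFieldNormedType.Exports.

(* The difference w = u2 - u1 satisfies w_t = \Delta w + c w with c bounded and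
   nonnegative, because 1/g is nondecreasing and Lipschitz on compact subsets of
   ]-oo, 1[. First, w >= 0: for a small time s, the negative part of w(., s) is
   dominated, up to e, by a finite superposition of heat kernels whose value at
   a later time t is at most C (t - s)^(-n/2) times the L^1 norm of that
   negative part. The minimum principle bounds the negative part of w(., t) by
   this superposition, and the L^1 norm tends to 0 with s. Now w is a
   nonnegative supersolution of the heat equation; comparison with
   compactly supported subsolutions on expanding balls, and connectedness of
   Omega, show that positivity at one point propagates to all of Omega at every
   later time. Finally w cannot vanish identically for small times, since then
   the initial values would agree almost everywhere. *)

Local Open Scope classical_set_scope.
Local Open Scope ring_scope.
Set Implicit Arguments.
Unset Strict Implicit.
Unset Printing Implicit Defensive.

(** * The heat operator along lines *)

Lemma is_derive1_estimate (R : realType) (f : R -> R) (x c e : R) :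
  is_derive x 1 f c -> 0 < e ->
  exists2 d, 0 < d & forall h, `|h| < d -> `|f (x + h) - f x - c * h| <= e * `|h|.
Proof.
move=> df e0.
have /cvgr_dist_le/(_ e e0) : (fun h => h^-1 *: (f (h + x) - f x)) @ 0^' --> c.
  have [fd <-] := df; move: fd => /cvg_ex[l fl].
  have -> : 'D_1 f x = l.
    by apply: cvg_lim => //.
  apply: cvg_trans fl; apply: near_eq_cvg; near=> h => /=.
  by rewrite [_%:A]mulr1.
move=> /nbhs_ballP[d /= d0 dP]; exists d => // h hd.
have [->|h0] := eqVneq h 0; first by rewrite addr0 mulr0 !subrr normr0 mulr0.
have := dP h; rewrite /ball/= sub0r normrN => /(_ hd h0).
rewrite [_ *: _]mulrC => H.
have -> : f (x + h) - f x - c * h = - (c - (f (h + x) - f x) / h) * h.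
  by rewrite (addrC h x); field.
by rewrite normrM normrN ler_wpM2r.
Unshelve. all: by end_near.
Qed.

(** If [c < 0], then [k' 0 = 0] at the minimum forces [k' s <= c * s / 2 < 0] just to the right of
    [0], and the mean value theorem makes [k] drop below [k 0]. Differentiability of [k'] is thus
    asked at [0] only. *)
Lemma second_derivative_min (R : realType) (k k' : R -> R) (c e : R) :
  0 < e -> (forall s : R, `|s| < e -> is_derive s 1 k (k' s)) ->
  is_derive (0 : R) 1 k' c -> (forall s, `|s| < e -> k 0 <= k s) -> 0 <= c.
Proof.
move=> e0 dk dk' kmin; rewrite leNgt; apply/negP => c0.
have k'0 : k' 0 = 0.
  have : is_derive (0 : R) 1 k 0.
    apply: (@derive1_at_min _ k (- e) e 0); first by rewrite ge0_cp// ltW.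
    - by move=> s; rewrite in_itv/= -ltr_norml => /dk[].
    - by rewrite in_itv/= oppr_lt0 e0.
    - by move=> s; rewrite in_itv/= -ltr_norml => /kmin.
  have := dk 0; rewrite normr0 => /(_ e0) /@derive_val <-.
  by move/@derive_val.
have c20 : 0 < - c / 2 by lra.
have [d d0 dP] := is_derive1_estimate dk' c20.
pose m := Num.min d e / 2.
have me : 0 < Num.min d e by rewrite lt_min d0.
have m0 : 0 < m by rewrite /m; lra.
have md : m < d by rewrite (@lt_le_trans _ _ (Num.min d e))// ?ge_min ?lexx// /m; lra.
have mE : m < e by rewrite (@lt_le_trans _ _ (Num.min d e))// ?ge_min ?lexx ?orbT// /m; lra.
have [||s] := @MVT _ k k' 0 m m0.
- by move=> s; rewrite in_itv/= => /andP[s0 sm]; apply: dk; rewrite gtr0_norm//; lra.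
- apply: derivable_within_continuous => s; rewrite in_itv/= => /andP[s0 sm].
  have /dk [] // : `|s| < e by rewrite ger0_norm//; lra.
rewrite in_itv/= => /andP[s0 sm] E.
have := dP s; rewrite add0r k'0 subr0 gtr0_norm// => /(_ (lt_trans sm md)).
rewrite ler_norml => /andP[_ H].
have k's : k' s < 0.
  have : c * s < 0 by rewrite nmulr_rlt0.
  lra.
have := kmin m; rewrite gtr0_norm// => /(_ mE).
have : k' s * (m - 0) < 0 by rewrite nmulr_rlt0// subr0.
lra.
Qed.

(** Only earlier times are compared, because a minimum over a space-time region may sit at its final
    time, where just this one-sided sign is available. *)
Lemma derivative_left_min (R : realType) (k : R -> R) (c t e : R) :
  0 < e -> is_derive t 1 k c -> (forall s, t - e < s < t -> k t <= k s) ->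
  c <= 0.
Proof.
move=> e0 dk kmin; rewrite leNgt; apply/negP => c0.
have c20 : 0 < c / 2 by lra.
have [d d0 dP] := is_derive1_estimate dk c20.
pose m := Num.min d e / 2.
have me : 0 < Num.min d e by rewrite lt_min d0.
have m0 : 0 < m by rewrite /m; lra.
have md : m < d by rewrite (@lt_le_trans _ _ (Num.min d e))// ?ge_min ?lexx// /m; lra.
have mE : m < e by rewrite (@lt_le_trans _ _ (Num.min d e))// ?ge_min ?lexx ?orbT// /m; lra.
have := dP (- m); rewrite normrN gtr0_norm// => /(_ md).
rewrite ler_norml => /andP[_].
have : k t <= k (t - m) by apply: kmin; apply/andP; lra.
have : 0 < c * m by rewrite mulr_gt0.
lra.
Qed.

(* [c] is the value of [q_t - \Delta q] at [(x, t)]. Only restrictions of [q] to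
   lines enter, so that everything reduces to one-variable calculus. *)
Definition heat_at (R : realType) (n : nat) (q : 'rV[R]_n -> R -> R)
    (x : 'rV[R]_n) (t c : R) : Prop :=
  exists (d e : R) (k : 'I_n -> R -> R) (l : 'I_n -> R),
    [/\ 0 < e, is_derive t 1 (q x) d,
        forall i (s : R), `|s| < e ->
          is_derive s 1 (fun r => q (x + r *: e_ R i) t) (k i s),
        forall i, is_derive (0 : R) 1 (k i) (l i) &
        c = d - \sum_i l i].

Section heat.
Context (R : realType) (n : nat).
Implicit Types (q : 'rV[R]_n -> R -> R) (x : 'rV[R]_n).

Lemma heat_at_min q x t c e : 0 < e ->
  heat_at q x t c ->
  (forall i (s : R), `|s| < e -> q x t <= q (x + s *: e_ R i) t) ->
  (forall s, t - e < s < t -> q x t <= q x s) -> c <= 0.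
Proof.
move=> e0 [d [e' [k [l [e'0 dt dx dx2 ->]]]]] minx mint.
have d0 : d <= 0 by apply: derivative_left_min e0 dt mint.
have l0 i : 0 <= l i.
  apply: (@second_derivative_min _ (fun r => q (x + r *: e_ R i) t) (k i) (l i)
    (Num.min e e')).
  - by rewrite lt_min e0.
  - by move=> s; rewrite lt_min => /andP[_]; exact: dx.
  - by move=> s; rewrite lt_min => /andP[+ _]; rewrite scale0r addr0; exact: minx.
have : 0 <= \sum_i l i by apply: sumr_ge0.
lra.
Qed.

Lemma heat_at_add q1 q2 x t c1 c2 :
  heat_at q1 x t c1 -> heat_at q2 x t c2 ->
  heat_at (fun y s => q1 y s + q2 y s) x t (c1 + c2).
Proof.
move=> [d1 [e1 [k1 [l1 [e10 dt1 dx1 dxx1 ->]]]]].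
move=> [d2 [e2 [k2 [l2 [e20 dt2 dx2 dxx2 ->]]]]].
exists (d1 + d2), (Num.min e1 e2), (fun i s => k1 i s + k2 i s),
  (fun i => l1 i + l2 i); split.
- by rewrite lt_min e10.
- exact: is_deriveD.
- move=> i s; rewrite lt_min => /andP[se1 se2].
  by apply: is_deriveD; [exact: dx1|exact: dx2].
- by move=> i; apply: is_deriveD.
- by rewrite big_split/=; ring.
Qed.

(** The factor depends on time alone, so the Laplacian does not see it; this serves for exponential
    weights and for constants. *)
Lemma heat_at_scale (p : R -> R) (p' : R) q x (t c : R) :
  is_derive t 1 p p' -> heat_at q x t c ->
  heat_at (fun y s => p s * q y s) x t (p t * c + p' * q x t).
Proof.
move=> dp [d [e [k [l [e0 dt dx dxx ->]]]]].
exists (p t * d + q x t * p'), e, (fun i s => p t * k i s), (fun i => p t * l i); split.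
- by [].
- exact: is_deriveM.
- by move=> i s se; exact: (@is_deriveZ _ _ _ _ (p t) _ _ _ (dx i s se)).
- by move=> i; exact: (@is_deriveZ _ _ _ _ (p t) _ _ _ (dxx i)).
- by rewrite -mulr_sumr; ring.
Qed.

Lemma heat_at_time (p : R -> R) (p' : R) x (t : R) :
  is_derive t 1 p p' -> heat_at (fun _ => p) x t p'.
Proof.
move=> dp; exists p', 1, (fun _ => cst 0), (fun=> 0); split => //.
- by move=> i s _; exact: is_derive_cst.
- by move=> i; exact: is_derive_cst.
- by rewrite big1// subr0.
Qed.

Lemma heat_at_eq q x t c c' : heat_at q x t c -> c = c' ->
  heat_at q x t c'.
Proof. by move=> + <-. Qed.

Lemma heat_at_sum (I : Type) (r : seq I) (q : I -> 'rV[R]_n -> R -> R)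
    (c : I -> R) x t :
  (forall i, heat_at (q i) x t (c i)) ->
  heat_at (fun y s => \sum_(i <- r) q i y s) x t (\sum_(i <- r) c i).
Proof.
move=> qc; elim: r => [|i r IH].
  rewrite big_nil (_ : (fun _ _ => _) = fun _ => cst 0); last first.
    by apply/funext => y; apply/funext => s; rewrite big_nil.
  by apply: heat_at_time; exact: is_derive_cst.
rewrite big_cons (_ : (fun _ _ => _) =
    fun y s => q i y s + \sum_(j <- r) q j y s); last first.
  by apply/funext => y; apply/funext => s; rewrite big_cons.
exact: heat_at_add.
Qed.

Lemma is_derive_line (h : 'rV[R]_n -> R) x i (s : R) :
  derivable h (x + s *: e_ R i) (e_ R i) ->
  is_derive s 1 (fun r => h (x + r *: e_ R i)) (partial i h (x + s *: e_ R i)).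
Proof.
have E : (fun r => r^-1 *: (((fun r => h (x + r *: e_ R i)) \o shift s)
      (r *: (1 : R)) - h (x + s *: e_ R i))) =
   (fun r => r^-1 *: ((h \o shift (x + s *: e_ R i)) (r *: e_ R i)
      - h (x + s *: e_ R i))).
  apply/funext => r /=; rewrite [_%:A]mulr1 scalerDl.
  by rewrite addrCA addrA.
move=> dh; apply: DeriveDef.
  by rewrite /derivable E.
by rewrite /partial /derive E.
Qed.

(** Openness of [Q] keeps a short segment in each axis direction inside [Q], so the first partials
    exist near [x] and not merely at [x]. *)
Lemma C21_heat_at (Q : set ('rV[R]_n * R)) q x t :
  open Q -> C21_on Q q -> Q (x, t) ->
  heat_at q x t (derive1 (q x) t - laplacian (q ^~ t) x).
Proof.
move=> oQ Cq Qxt.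
have [e /= e0 eP] : exists2 e : R, 0 < e &
    forall i (s : R), `|s| < e -> Q (x + s *: e_ R i, t).
  have /nbhs_ballP[e /= e0 eQ] : nbhs (x, t) Q by exact: open_nbhs_nbhs.
  exists e => // i s se; apply: eQ; split => /=; last exact: ballxx.
  split => // a b; rewrite /ball/= !mxE opprD addrA subrr sub0r normrN normrM.
  apply: le_lt_trans se.
  by rewrite ler_piMr//; case: (_ && _); rewrite ?normr1 ?normr0 ?ler01.
have [_ [dt _] dx dxx] := Cq _ _ Qxt.
exists (derive1 (q x) t), e,
  (fun i s => partial i (q ^~ t) (x + s *: e_ R i)),
  (fun i => partial i (partial i (q ^~ t)) x); split.
- exact: e0.
- by rewrite derive1E; exact: derivableP.
- move=> i s se; apply: is_derive_line.
  by have [_ _ /(_ i)[]] := Cq _ _ (eP i s se).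
- move=> i; have [di _] := dxx i i.
  have E0 : x + (0 : R) *: e_ R i = x by rewrite scale0r addr0.
  by have := @is_derive_line (partial i (q ^~ t)) x i 0; rewrite E0 => /(_ di).
- by [].
Qed.

End heat.

(** * The squared Euclidean norm and radial functions *)

Section sqn.
Context (R : realType) (n : nat).
Implicit Types (x y : 'rV[R]_n).

(** The ambient norm is the max norm; barriers and heat kernels need the Euclidean one, whose square
    is a quadratic polynomial along each line. *)
Definition sqn x : R := \sum_i x ord0 i ^+ 2.

Lemma sqn_ge0 x : 0 <= sqn x.
Proof. by apply: sumr_ge0 => i _; exact: sqr_ge0. Qed.

Lemma sqn0 : sqn 0 = 0.
Proof. by rewrite /sqn big1// => i _; rewrite mxE expr0n. Qed.

Lemma coord_le_norm x i : `|x ord0 i| <= `|x|.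
Proof.
rewrite [leRHS]/Num.Def.normr/= mx_normrE.
by apply/bigmax_geP; right; exists (ord0, i).
Qed.

Lemma norm_le_coord x e : 0 <= e -> (forall i, `|x ord0 i| <= e) -> `|x| <= e.
Proof.
move=> e0 xe; rewrite [leLHS]/Num.Def.normr/= mx_normrE.
by apply/bigmax_leP; split => // -[i j] _ /=; rewrite (ord1 i).
Qed.

Lemma sqr_coord_le_sqn x i : x ord0 i ^+ 2 <= sqn x.
Proof.
by rewrite /sqn (bigD1 i)//= lerDl sumr_ge0// => j _; exact: sqr_ge0.
Qed.

Lemma norm_le_sqn x e : 0 <= e -> sqn x <= e ^+ 2 -> `|x| <= e.
Proof.
move=> e0 xe; apply: norm_le_coord => // i.
rewrite -ler_sqr ?nnegrE// real_normK ?num_real//.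
exact: le_trans (sqr_coord_le_sqn x i) xe.
Qed.

Lemma sqn_le_norm x e : (forall i, `|x ord0 i| <= e) -> sqn x <= n%:R * e ^+ 2.
Proof.
move=> xe; rewrite -[n in n%:R]card_ord -sumr_const mulr_suml ler_sum// => i _.
rewrite mul1r -real_normK ?num_real// ler_sqr ?nnegrE//.
exact: le_trans (xe i).
Qed.

Lemma sqn_line x i s :
  sqn (x + s *: e_ R i) = sqn x + (2 * s * x ord0 i + s ^+ 2).
Proof.
rewrite /sqn (bigD1 i)//= [in RHS](bigD1 i)//= !mxE !eqxx/=.
rewrite (eq_bigr (fun j => x ord0 j ^+ 2)) => [|j ji]; last first.
  by rewrite !mxE/= (negbTE ji) mulr0 addr0.
by ring.
Qed.

Lemma sqn_continuous y : continuous (fun x => sqn (x - y)).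
Proof.
apply: continuous_big => [|i _ x]; first exact: add_continuous.
rewrite (_ : (fun _ => _) = fun x => (x ord0 i - y ord0 i) ^+ 2); last first.
  by apply/funext => z; rewrite !mxE.
have c : {for x, continuous (fun z : 'rV[R]_n => z ord0 i - y ord0 i)}.
  apply: (@continuousB _ _ _ (fun z : 'rV[R]_n => z ord0 i) (cst (y ord0 i))).
    exact: (@coord_continuous R _ _ ord0 i x).
  exact: cst_continuous.
exact: (continuousM c c).
Qed.

End sqn.

(** A tool for elementary derivatives: [k] is identified with a polynomial, and [d] is kept apart so
    that both premises are ring identities. *)
Lemma is_derive_quadratic (R : realType) (k : R -> R) (a b c s d : R) :
  (forall r, k r = a + b * r + c * r ^+ 2) -> b + 2 * c * s = d ->
  is_derive s 1 k d.
Proof.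
move=> kE <-.
have -> : k = horner (a%:P + b%:P * 'X + c%:P * 'X ^+ 2).
  apply/funext => r; rewrite kE.
  by rewrite !(hornerD, hornerM, hornerXn, hornerX, hornerC).
apply: is_derive_eq.
rewrite !(derivD, derivC, derivM, derivX, derivXn).
rewrite !(hornerD, hornerMn, hornerM, hornerXn, hornerX, hornerC)/=; ring.
Qed.

(** With [r] the squared distance to [y] and [b i] the coordinates of [x - y], the chain rule gives
    the second derivative [2 * F' + 4 * b i ^+ 2 * F''] along axis [i]; summing over [i] yields
    $\Delta F = 2nF' + 4rF''$. *)
Lemma heat_at_radial (R : realType) (n : nat) (F : R -> R -> R) (F1 : R -> R)
    (y x : 'rV[R]_n) (t Ft F2 : R) :
  is_derive t 1 (F (sqn (x - y))) Ft ->
  (forall r : R, is_derive r 1 (F ^~ t) (F1 r)) ->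
  is_derive (sqn (x - y)) 1 F1 F2 ->
  heat_at (fun z s => F (sqn (z - y)) s) x t
    (Ft - (2 * n%:R * F1 (sqn (x - y)) + 4 * sqn (x - y) * F2)).
Proof.
move=> dt dr drr.
pose b i := (x - y) ord0 i; set r0 := sqn _ in dt drr *.
have lineE i s : sqn (x + s *: e_ R i - y) = r0 + (2 * s * b i + s ^+ 2).
  by rewrite addrAC sqn_line.
have dline i (s : R) : is_derive s 1 (fun s => r0 + (2 * s * b i + s ^+ 2))
   (2 * b i + 2 * s).
  by apply: (@is_derive_quadratic _ _ r0 (2 * b i) 1) => [r|]; ring.
exists Ft, 1, (fun i s => F1 (r0 + (2 * s * b i + s ^+ 2)) * (2 * b i + 2 * s)),
  (fun i => F1 r0 * 2 + 2 * b i * (F2 * (2 * b i))); split.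
- by [].
- by [].
- move=> i s _.
  have -> : (fun r => F (sqn (x + r *: e_ R i - y)) t) =
      (F ^~ t) \o (fun s => r0 + (2 * s * b i + s ^+ 2)).
    by apply/funext => z/=; rewrite lineE.
  by apply: is_derive1_comp.
- move=> i; have E0 : r0 + (2 * 0 * b i + 0 ^+ 2) = r0 by ring.
  have d1 : is_derive (0 : R) 1 (F1 \o (fun s => r0 + (2 * s * b i + s ^+ 2)))
      (F2 * (2 * b i + 2 * 0)).
    by apply: is_derive1_comp; rewrite E0.
  have d2 : is_derive (0 : R) 1 (fun s => 2 * b i + 2 * s) 2.
    by apply: (@is_derive_quadratic _ _ (2 * b i) 2 0) => [r|]; ring.
  have := is_deriveM d1 d2; move/is_derive_eq; apply => /=.
  by rewrite E0 /GRing.scale/=; ring.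
- congr (_ - _); rewrite big_split/= sumr_const card_ord -mulr_natl.
  rewrite (_ : \sum_i _ = 4 * r0 * F2); first by ring.
  rewrite /r0 /sqn -mulrA mulr_suml mulr_sumr; apply: eq_bigr => i _.
  by rewrite /b; ring.
Qed.

(** * Minimum principle and propagation of positivity *)

Section min_principle.
Context (R : realType) (n : nat).
Implicit Types (D : set ('rV[R]_n * R)) (q : 'rV[R]_n -> R -> R).

(** At a negative minimum of [q] over [D] the heat operator would be both positive, by hypothesis,
    and nonpositive, by minimality. Boundary conditions are encoded by the neighbourhood clause: a
    point where [q] is negative may not lie on the parabolic boundary of [D]. *)
Lemma heat_min_principle D q : compact D ->
  {within D, continuous (fun p => q p.1 p.2)} ->
  (forall x t, D (x, t) -> q x t < 0 ->
    (exists2 c, 0 < c & heat_at q x t c) /\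
    \forall p \near (x, t), p.2 <= t -> D p) ->
  forall x t, D (x, t) -> 0 <= q x t.
Proof.
move=> cD cq qP x t Dxt; rewrite leNgt; apply/negP => qxt.
have [[y s] /set_mem Dys /= ymin] := compact_EVT_min (ex_intro _ _ Dxt) cD cq.
have qys : q y s < 0 by apply: le_lt_trans qxt; apply: (ymin (x, t)); exact/mem_set.
have [[c c0 hc] /nbhs_ballP[e /= e0 eD]] := qP _ _ Dys qys.
suff : c <= 0 by rewrite leNgt c0.
apply: (heat_at_min e0 hc) => [i r re|r /andP[r1 r2]].
  apply: (ymin (_, s)); apply/mem_set/eD => //; split => /=; last exact: ballxx.
  split => // a b; rewrite /ball/= !mxE opprD addrA subrr sub0r normrN normrM.
  apply: le_lt_trans re.
  by rewrite ler_piMr//; case: (_ && _); rewrite ?normr1 ?normr0 ?ler01.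
apply: (ymin (y, r)); apply/mem_set/eD => /=; last exact: ltW.
by split => /=; [exact: ballxx|rewrite /ball/= gtr0_norm ?subr_gt0//; lra].
Qed.

Lemma sqn_fst_continuous (y : 'rV[R]_n) :
  continuous (fun p : 'rV[R]_n * R => sqn (p.1 - y)).
Proof.
move=> p.
apply: (@continuous_comp _ _ _ (@fst 'rV[R]_n R) (fun x : 'rV[R]_n => sqn (x - y)) p).
  exact: cvg_fst.
exact: sqn_continuous.
Qed.

Lemma sub_sqn_continuous (y : 'rV[R]_n) (P : R -> R) : continuous P ->
  continuous (fun p : 'rV[R]_n * R => P p.2 - sqn (p.1 - y)).
Proof.
move=> cP p.
apply: (@continuousB _ _ _ (fun p : 'rV[R]_n * R => P p.2)
  (fun p => sqn (p.1 - y))); last exact: sqn_fst_continuous.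
by apply: (@continuous_comp _ _ _ (@snd 'rV[R]_n R) P); [exact: cvg_snd|exact: cP].
Qed.

Lemma compact_sqn_ball (y : 'rV[R]_n) r : compact [set x | sqn (x - y) <= r].
Proof.
apply: bounded_closed_compact; last first.
  apply: (@preimage_closed _ _ (fun x : 'rV[R]_n => sqn (x - y)) [set s | s <= r]).
    by move=> x _; exact: sqn_continuous.
  exact: closed_le.
(* The radius [1 + |r|] avoids a square root, since $|r| \le (1+|r|)^2$. *)
exists (`|y| + (1 + `|r|)); split; first by rewrite num_real.
move=> M yM x /= xr; apply: le_trans (ltW yM).
rewrite -[x](subrK y) addrC (le_trans (ler_normD _ _))// lerD2l.
apply: norm_le_sqn; first by rewrite addr_ge0.
apply: (le_trans xr); apply: (le_trans (ler_norm r)).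
by rewrite expr2; have := normr_ge0 r; nra.
Qed.

End min_principle.

(** * Comparison with a subsolution on an expanding ball *)

Section barrier.
Context (R : realType) (n : nat).
Variables (w : 'rV[R]_n -> R -> R) (x1 : 'rV[R]_n) (t1 t2 r : R).
Let cyl := [set p : 'rV[R]_n * R | sqn (p.1 - x1) <= r /\ t1 <= p.2 <= t2].
Hypothesis r0 : 0 < r.
Hypothesis t12 : t1 < t2.
Hypothesis cw : {within cyl, continuous (fun p => w p.1 p.2)}.
Hypothesis w0 : forall x t, cyl (x, t) -> 0 <= w x t.
Hypothesis hw : forall (x : 'rV[R]_n) (t : R), sqn (x - x1) < r -> t1 < t <= t2 ->
  exists2 c : R, 0 <= c & heat_at w x t c.

Lemma initial_lower_bound : 0 < w x1 t1 ->
  exists rho m, [/\ 0 < rho < r, 0 < m &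
    forall x, sqn (x - x1) <= rho -> m <= w x t1].
Proof.
move=> w1; have c1 : cyl (x1, t1).
  by split; rewrite /= ?subrr ?sqn0 ?lexx ltW.
have w20 : 0 < w x1 t1 / 2 by rewrite divr_gt0.
have /subspace_continuousP/(_ _ c1)/cvgr_dist_lt/(_ _ w20) := cw.
rewrite /within/= => /nbhs_ballP[e /= e0 eP].
(* The first bound keeps [x] within max-norm distance [e / 2] of [x1]; the second forces
   [rho < r]. *)
exists (Num.min ((e / 2) ^+ 2) (r / 2)), (w x1 t1 / 2).
have e20 : 0 < (e / 2) ^+ 2 by rewrite exprn_gt0// divr_gt0.
split => //.
  by rewrite lt_min e20 gt_min/=; apply/andP; split; [|apply/orP; right]; move: r0; lra.
move=> x; rewrite le_min => /andP[xe xr].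
have /(_ _ _)/ltW := eP (x, t1) _ _.
have bx : ball (x1, t1) e (x, t1).
  split => /=; last exact: ballxx.
  rewrite mx_norm_ball /ball_/= distrC (@le_lt_trans _ _ (e / 2))//; last by lra.
  by apply: norm_le_sqn => //; rewrite divr_ge0// ltW.
move=> /(_ bx); rewrite /cyl/= => H.
have {H} : `|w x1 t1 - w x t1| <= w x1 t1 / 2.
  by apply: H; split; [move: r0; lra|rewrite lexx ltW].
by rewrite ler_norml => /andP[_]; lra.
Qed.

(* [w] is compared with [C exp(-b (t - t1)) (P t - |x - x1|^2)^2] on the region
   [|x - x1|^2 <= P t], where [P] is affine, [P t1 = rho] and [P t2 = r]; this is
   a strict subsolution of the heat equation once [b] is large. *)
Lemma barrier_positivity : 0 < w x1 t1 ->
  forall x, sqn (x - x1) < r -> 0 < w x t2.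
Proof.
move=> /initial_lower_bound[rho [m [/andP[rho0 rhor] m0 wm]]] x xr.
pose k := (r - rho) / (t2 - t1).
have k0 : 0 < k by rewrite divr_gt0// subr_gt0.
(* The heat operator sends $(P-s)^2$, where [s] is the squared distance, to
   [L * (P t - s) - 8 * P t]; [b] is chosen below so that a square can be completed. *)
pose L := 2 * k + 4 * n%:R + 8.
have L0 : 0 < L by rewrite /L; have := ler0n R n; lra.
pose b := L ^+ 2 / rho.
pose P t := rho + k * (t - t1).
have P2 : P t2 = r by rewrite /P /k; field; move: t12; lra.
have Prho t : t1 <= t -> rho <= P t.
  by move=> tt1; rewrite /P lerDl mulr_ge0 ?subr_ge0// ltW.
have Pr t : t <= t2 -> P t <= r.
  by move=> tt2; rewrite -P2 /P lerD2l ler_pM2l// lerD2r.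
(* The sign is negative because the barrier is subtracted from [w]. Dividing by [rho ^+ 2] keeps the
   barrier below [m] at time [t1], where [F] is at most [rho ^+ 2]. *)
pose a t := - (m / rho ^+ 2) * expR (- b * (t - t1)).
pose F s t := (P t - s) ^+ 2.
have a0 t : a t < 0 by rewrite /a mulNr oppr_lt0 mulr_gt0 ?expR_gt0// divr_gt0 ?exprn_gt0.
pose D := ([set x | sqn (x - x1) <= r] `*` `[t1, t2]%classic) `&`
  [set p : 'rV[R]_n * R | 0 <= P p.2 - sqn (p.1 - x1)].
have DE y t : D (y, t) <-> t1 <= t <= t2 /\ sqn (y - x1) <= P t.
  rewrite /D/=; split => [[[y1]]|[tt yP]].
    by rewrite in_itv/= subr_ge0.
  split; [split|]; [|by rewrite /= in_itv|by rewrite /= subr_ge0].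
  by case/andP : tt => _ /Pr; exact: le_trans.
have dP (t : R) : is_derive t 1 P k.
  by apply: (@is_derive_quadratic _ _ (rho - k * t1) k 0) => [s|]; rewrite /P; ring.
have cP : continuous P.
  by move=> t; apply/differentiable_continuous/derivable1_diffP; apply: ex_derive.
have cD : compact D.
  apply: compact_closedI.
    by apply: compact_setX; [exact: compact_sqn_ball|exact: segment_compact].
  apply: (@preimage_closed _ _
    (fun p : 'rV[R]_n * R => P p.2 - sqn (p.1 - x1)) [set s | 0 <= s]).
    by move=> p _; exact: sub_sqn_continuous.
  exact: closed_ge.
have da (t : R) : is_derive t 1 a (- b * a t).
  have d1 : is_derive t 1 (fun t => - b * (t - t1)) (- b).
    by apply: (@is_derive_quadratic _ _ (b * t1) (- b) 0) => [s|]; ring.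
  have d2 : is_derive t 1 (expR \o (fun t => - b * (t - t1))) (expR (- b * (t - t1)) * - b).
    exact: is_derive1_comp.
  have := is_deriveZ (- (m / rho ^+ 2)) d2; move/is_derive_eq; apply.
  by rewrite /a /GRing.scale/=; ring.
pose q y t := w y t + a t * F (sqn (y - x1)) t.
suff : forall y t, D (y, t) -> 0 <= q y t.
  have xD : D (x, t2) by apply/DE; rewrite P2 lexx !ltW.
  move=> /(_ _ _ xD); rewrite /q /F P2.
  have : a t2 * (r - sqn (x - x1)) ^+ 2 < 0.
    by rewrite nmulr_rlt0// exprn_gt0// subr_gt0.
  lra.
apply: heat_min_principle => //.
  apply: within_continuousD.
    apply: continuous_subspaceW cw => -[y t] /DE[tt yP]; split => //=.
    by case/andP : tt => _ /Pr; exact: le_trans.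
  apply: continuous_subspaceT => p.
  have cF := @sub_sqn_continuous _ _ x1 _ cP p.
  apply: (@continuousM _ _ (fun p : 'rV[R]_n * R => a p.2)
    (fun p => F (sqn (p.1 - x1)) p.2)); last exact: (continuousM cF cF).
  apply: (@continuous_comp _ _ _ (@snd 'rV[R]_n R) a); first exact: cvg_snd.
  by apply/differentiable_continuous/derivable1_diffP; apply: ex_derive.
move=> y t /DE[/andP[t1t tt2] yP] qyt.
have wyt : 0 <= w y t.
  by apply: w0; split => /=; [exact: le_trans (Pr _ tt2)|rewrite t1t].
(* On the lateral surface the barrier vanishes and [q] equals [w], which is nonnegative. *)
have yP' : sqn (y - x1) < P t.
  rewrite lt_neqAle yP andbT; apply/eqP => E; move: qyt.
  by rewrite /q /F E subrr expr0n mulr0 addr0 ltNge wyt.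
(* At the initial time the barrier is at most [m], hence at most [w]. *)
have t1t' : t1 < t.
  rewrite lt_neqAle t1t andbT; apply/eqP => E; move: qyt yP.
  rewrite /q /F /a /P -E subrr !mulr0 expR0 mulr1 addr0 => + yrho.
  have := wm _ yrho; have := sqn_ge0 (y - x1).
  set s := sqn _ in yrho * => s0 mw.
  have : (rho - s) ^+ 2 <= rho ^+ 2 by rewrite ler_sqr ?nnegrE; lra.
  rewrite -(ler_pM2l (divr_gt0 m0 (exprn_gt0 2 rho0))) divfK ?gt_eqF ?exprn_gt0//.
  lra.
split; last first.
  near=> p => pt; rewrite [p]surjective_pairing; apply/DE; split.
    apply/andP; split; last exact: le_trans tt2.
    by near: p; apply: cvgr_ge (@cvg_snd _ _ _ _ _) _ t1t'.
  rewrite -subr_ge0; apply/ltW; near: p.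
  apply: (cvgr_gt _ (@sub_sqn_continuous _ _ x1 _ cP (y, t))).
  by rewrite /= subr_gt0.
have [||c c0 hc] := hw (x := y) (t := t).
- exact: lt_le_trans (Pr _ tt2).
- by rewrite t1t'.
have hF : heat_at (fun y t => F (sqn (y - x1)) t) y t
   (2 * k * (P t - sqn (y - x1)) -
     (2 * n%:R * (- 2 * (P t - sqn (y - x1))) + 4 * sqn (y - x1) * 2)).
  have dFt : is_derive t 1 (F (sqn (y - x1))) (2 * k * (P t - sqn (y - x1))).
    set s := sqn _.
    by apply: (@is_derive_quadratic _ _ ((rho - k * t1 - s) ^+ 2)
      (2 * k * (rho - k * t1 - s)) (k ^+ 2)) => [u|]; rewrite /F /P; ring.
  have dF (s : R) : is_derive s 1 (F ^~ t) (- 2 * (P t - s)).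
    by apply: (@is_derive_quadratic _ _ (P t ^+ 2) (- 2 * P t) 1) => [u|];
      rewrite /F; ring.
  have dF2 : is_derive (sqn (y - x1)) 1 (fun s => - 2 * (P t - s)) 2.
    by apply: (@is_derive_quadratic _ _ (- 2 * P t) 2 0) => [u|]; ring.
  exact: (@heat_at_radial R n F (fun s => - 2 * (P t - s)) x1 y t
    (2 * k * (P t - sqn (y - x1))) 2 dFt dF dF2).
have := heat_at_add hc (heat_at_scale (da t) hF).
set c' := _ + _ => hq; exists c' => //.
rewrite /c' ltr_wpDl//.
move: yP' (Prho _ t1t); rewrite /F; set s := sqn _ => yP' Pt.
rewrite (_ : _ + _ = - a t * (b * (P t - s) ^+ 2 - L * (P t - s) + 8 * P t));
  last by rewrite /L; ring.
rewrite pmulr_rgt0 ?oppr_gt0//.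
(* Since [P t >= rho], it suffices to treat [8 * rho]; the choice [b = L ^+ 2 / rho] then turns the
   expression into a square plus a positive constant, over [rho]. *)
apply: (@lt_le_trans _ _ (b * (P t - s) ^+ 2 - L * (P t - s) + 8 * rho)); last first.
  by rewrite lerD2l ler_pM2l.
rewrite (_ : _ + _ = ((L * (P t - s) - rho / 2) ^+ 2 + (8 - 1 / 4) * rho ^+ 2) / rho);
  last by rewrite /b; field; lra.
rewrite divr_gt0// ltr_wpDl ?sqr_ge0// mulr_gt0 ?exprn_gt0//; lra.
Unshelve. all: by end_near.
Qed.

End barrier.

(** * Propagation of positivity through a connected open set *)

Section strong_positivity.
Context (R : realType) (n : nat).
Variables (Omega : set 'rV[R]_n) (T : R) (w : 'rV[R]_n -> R -> R).
Hypothesis cw : forall x t, Omega x -> 0 < t < T ->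
  {for (x, t), continuous (fun p : 'rV[R]_n * R => w p.1 p.2)}.
Hypothesis w0 : forall x t, Omega x -> 0 < t < T -> 0 <= w x t.
Hypothesis hw : forall x t, Omega x -> 0 < t < T ->
  exists2 c, 0 <= c & heat_at w x t c.

Lemma positivity_in_ball (x0 : 'rV[R]_n) (r t : R) : 0 < r ->
  (forall y, `|x0 - y| <= r -> Omega y) -> 0 < t < T -> 0 < w x0 t ->
  forall y s, `|x0 - y| <= r / n.+1%:R -> t < s < T -> 0 < w y s.
Proof.
move=> r0 rO /andP[t0 tT] wx0 y s yr /andP[ts sT].
have nrO z : sqn (z - x0) <= r ^+ 2 -> Omega z.
  by move=> zr; apply: rO; rewrite distrC norm_le_sqn// ltW.
have tsT u : t <= u <= s -> 0 < u < T.
  move=> /andP[tu us]; rewrite (lt_le_trans t0 tu)/=.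
  exact: le_lt_trans us sT.
apply: (@barrier_positivity R n w x0 t s (r ^+ 2)) => //.
- by rewrite exprn_gt0.
- apply: continuous_in_subspaceT => -[z u]; rewrite inE => -[/= zr tu].
  by apply: cw; [exact: nrO|exact: tsT].
- by move=> z u [/= zr tu]; apply: w0; [exact: nrO|exact: tsT].
- move=> z u zr /andP[tu us]; apply: hw; first exact/nrO/ltW.
  by apply: tsT; rewrite (ltW tu).
have yi i : `|(y - x0) ord0 i| <= r / n.+1%:R.
  by apply: le_trans (coord_le_norm _ i) _; rewrite distrC.
(* The max-norm ball of radius [r / n.+1] lies in the open Euclidean ball of radius [r] because $n <
   (n+1)^2$. *)
apply: le_lt_trans (sqn_le_norm yi) _.
rewrite expr_div_n mulrCA -[ltRHS]mulr1 ltr_pM2l ?exprn_gt0//.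
rewrite ltr_pdivrMr ?exprn_gt0// mul1r -natrX ltr_nat.
by rewrite expnS expn1 mulSn ltn_addr.
Qed.

(** The set [A] of points where [w] is positive at all times after [t1] is nonempty, open and
    relatively closed in [Omega]. The point is that the radius to which positivity spreads depends
    only on the room inside [Omega], not on the elapsed time. *)
Lemma strong_positivity (x1 : 'rV[R]_n) (t1 : R) : open Omega ->
  connected Omega -> Omega x1 -> 0 < t1 < T -> 0 < w x1 t1 ->
  forall x t, Omega x -> t1 < t < T -> 0 < w x t.
Proof.
move=> oO cO Ox1 t1T wx1.
have closed_ballO x : Omega x ->
    exists2 r : R, 0 < r & forall y, `|x - y| <= r -> Omega y.
  move=> Ox; have /nbhs_ballP[e /= e0 eO] : nbhs x Omega by exact: open_nbhs_nbhs.
  exists (e / 2); first by rewrite divr_gt0.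
  move=> y xy; apply: eO; rewrite mx_norm_ball /ball_/=.
  by apply: le_lt_trans xy _; lra.
pose A := [set x | Omega x /\ forall t, t1 < t < T -> 0 < w x t].
have spread x y r : 0 < r -> (forall z, `|x - z| <= r -> Omega z) ->
    A x -> `|x - y| <= r / n.+1%:R -> A y.
  move=> r0 rO [Ox Ax] xy; split.
    by apply: rO; apply: le_trans xy _; rewrite ler_pdivrMr// ler_peMr ?ler1n// ltW.
  (* Positivity at [x] is used at the midpoint, which leaves the second half of the time interval
     for spreading to [y]. *)
  move=> t /andP[t1t tT]; have t1s : t1 < (t1 + t) / 2 by lra.
  have st : (t1 + t) / 2 < t by lra.
  apply: (positivity_in_ball r0 rO _ _ xy (t := (t1 + t) / 2)).
  - by case/andP : t1T => ? ?; apply/andP; lra.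
  - by apply: Ax; rewrite t1s (lt_trans st).
  - by rewrite st.
suff -> : Omega = A by move=> x t [_]; exact.
apply/esym; apply: cO.
- exists x1; split=> // t /andP[t1t tT]; have [r r0 rO] := closed_ballO _ Ox1.
  apply: (positivity_in_ball r0 rO t1T wx1 (y := x1)); last by rewrite t1t.
  by rewrite subrr normr0 divr_ge0// ltW.
- exists A; last by apply/seteqP; split => [x Ax|x []//]; split => //; case: Ax.
  rewrite openE => x Ax; have [r r0 rO] := closed_ballO _ (proj1 Ax).
  apply/nbhs_ballP; exists (r / n.+1%:R); first by rewrite /= divr_gt0.
  move=> y; rewrite mx_norm_ball /ball_/= => /ltW; exact: spread Ax.
- exists (closure A); first exact: closed_closure.
  apply/seteqP; split => [x Ax|x [Ox clA]].
    by split; [case: Ax|exact: subset_closure].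
  have [r r0 rO] := closed_ballO _ Ox.
  (* A point [y] of [A] this close to [x] still has a ball of radius [r / 2] inside [Omega], and
     positivity spreads from [y] back to [x]. *)
  have rn0 : 0 < r / 2 / n.+1%:R by rewrite !divr_gt0.
  have [y [Ay]] := clA _ (nbhsx_ballx x _ rn0).
  rewrite mx_norm_ball /ball_/= => xy.
  apply: (spread y x (r / 2)) => //; [by rewrite divr_gt0| |by rewrite distrC ltW].
  move=> z yz; apply: rO; rewrite -(subrKA y) (le_trans (ler_normD _ _))//.
  rewrite (splitr r) lerD//; apply: le_trans (ltW xy) _.
  by rewrite ler_pdivrMr// ler_peMr ?ler1n// divr_ge0// ltW.
Qed.

End strong_positivity.

(** * Heat kernels *)

(** Half-open, so that the cells of a grid are pairwise disjoint. *)
Definition cube (R : realType) n (a : 'I_n -> R) (d : R) : set 'rV[R]_n :=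
  [set x | forall i, a i <= x ord0 i < a i + d].

Lemma measurable_cube (R : realType) n (a : 'I_n -> R) d :
  measurable (cube a d).
Proof.
rewrite (_ : cube a d = \bigcap_(i in [set: 'I_n])
    ((fun x : 'rV[R]_n => x ord0 i) @^-1` `[a i, a i + d[%classic)).
  apply: fin_bigcap_measurable => // i _; rewrite -[X in measurable X]setTI.
  apply: (@continuous_measurable_rV R n (fun x => x ord0 i)) => //.
  exact: coord_continuous.
by apply/seteqP; split => [x ax i _|x ax i];
  [rewrite /= in_itv; exact: ax|have := ax i I; rewrite /= in_itv].
Qed.

(** Induction on the dimension, splitting off coordinate [0]: the preimage of a cube under [cons_rV]
    is an interval times a cube. In dimension [0] the cube is the whole one-point space, of Dirac
    mass [1]. *)
Lemma lebesgue_cube (R : realType) n (a : 'I_n -> R) d : 0 < d ->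
  lebesgue_rV R n (cube a d) = (d ^+ n)%:E.
Proof.
move=> d0; elim: n a => [|n IH] a.
  by rewrite /= diracE mem_set// => -[].
rewrite /= /lebesgue_step /pushforward.
have -> : @cons_rV R n @^-1` cube a d =
    `[a ord0, a ord0 + d[%classic `*` cube (a \o lift ord0) d.
  have consE b (y : 'rV[R]_n) : cons_rV (b, y) ord0 ord0 = b /\
      forall i, cons_rV (b, y) ord0 (lift ord0 i) = y ord0 i.
    have := cons_rVK (b, y); rewrite /uncons_rV => -[Eb /rowP Ey]; split => // i.
    by rewrite -Ey [RHS]mxE; congr (cons_rV (b, y) _ _); exact/val_inj.
  apply/seteqP; split => [[b y]/= H|[b y]/= [bH yH] i]; have [Eb Ey] := consE b y.
    split => [|i]; first by rewrite /= in_itv/=; have := H ord0; rewrite Eb.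
    by have := H (lift ord0 i); rewrite Ey.
  case: (unliftP ord0 i) => [j ->|->]; last by move: bH; rewrite in_itv/= Eb.
  by rewrite Ey; exact: yH.
rewrite product_measure1E//; last exact: measurable_cube.
have mE : @lebesgue_measure R `[a ord0, a ord0 + d[%classic = d%:E.
  rewrite lebesgue_measure_itv/= lte_fin ltrDl d0 -EFinD.
  by congr (_%:E); ring.
by rewrite IH exprS EFinM -mE.
Qed.

(** The heat kernel $t^{-n/2}e^{-r/(4t)}$ without its normalising constant; [r] stands for a squared
    distance, and the power of [t] is written through [ln]. *)
Definition gauss (R : realType) (n : nat) (r t : R) : R :=
  expR (- r / (4 * t) - n%:R / 2 * ln t).

Section gauss.
Context (R : realType) (n : nat).

(** With [tau = t - s], one has $F' = -F/(4\tau)$, $F'' = F/(16\tau^2)$ and $F_t = F\,(r/(4\tau^2) -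
    n/(2\tau))$, which cancel in the radial formula. *)
Lemma heat_at_gauss (x y : 'rV[R]_n) (t s : R) : s < t ->
  heat_at (fun z u => gauss n (sqn (z - y)) (u - s)) x t 0.
Proof.
move=> st; have ts0 : 0 < t - s by rewrite subr_gt0.
set tau := t - s in ts0.
pose F r u : R := gauss n r (u - s).
have dF (r : R) : is_derive r 1 (F ^~ t) (- (4 * tau)^-1 * F r t).
  rewrite mulrC; apply: (@is_derive1_comp _ expR
    (fun r => - r / (4 * tau) - n%:R / 2 * ln tau)).
  by apply: (@is_derive_quadratic _ _ (- (n%:R / 2 * ln tau)) (- (4 * tau)^-1) 0)
    => [u|]; ring.
set r := sqn (x - y).
have dFt : is_derive t 1 (F r) (F r t * (r / (4 * tau ^+ 2) - n%:R / 2 / tau)).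
  apply: (@is_derive1_comp _ expR (fun u => - r / (4 * (u - s)) - n%:R / 2 * ln (u - s))).
  have d1 : is_derive t 1 (fun u => u - s) 1.
    by apply: (@is_derive_quadratic _ _ (- s) 1 0) => [u|]; ring.
  have d2 : is_derive t 1 (@ln R \o (fun u => u - s)) (tau^-1 * 1).
    by apply: is_derive1_comp; exact: is_derive1_ln.
  have tau0 : tau != 0 by rewrite gt_eqF.
  have d3 := is_deriveV (tau0 : (fun u => u - s) t != 0) d1.
  have := is_deriveB (is_deriveZ (- r / 4) d3) (is_deriveZ (n%:R / 2) d2).
  have -> : (- r / 4) \*: (fun u => (u - s)^-1) - (n%:R / 2) \*: (@ln R \o (fun u => u - s))
     = (fun u => - r / (4 * (u - s)) - n%:R / 2 * ln (u - s)).
    apply/funext => u /=; rewrite /GRing.scale/= invfM; congr (_ - _).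
    by rewrite !mulrA.
  move/is_derive_eq; apply.
  by rewrite /GRing.scale/= -/tau; field.
have dF2 : is_derive r 1 (fun r => - (4 * tau)^-1 * F r t)
    (- (4 * tau)^-1 * (- (4 * tau)^-1 * F r t)).
  exact: (is_deriveZ (- (4 * tau)^-1) (dF r)).
apply: heat_at_eq (heat_at_radial dFt dF dF2) _.
rewrite -/r; field.
by rewrite gt_eqF.
Qed.

Lemma gauss_continuous (y : 'rV[R]_n) (s : R) (p : 'rV[R]_n * R) : s < p.2 ->
  {for p, continuous (fun p : 'rV[R]_n * R => gauss n (sqn (p.1 - y)) (p.2 - s))}.
Proof.
move=> sp; have ps0 : 0 < p.2 - s by rewrite subr_gt0.
have c2 : {for p, continuous (fun p : 'rV[R]_n * R => p.2 - s)}.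
  apply: (@continuousB _ _ _ (@snd 'rV[R]_n R) (cst s)); first exact: cvg_snd.
  exact: cst_continuous.
apply: (@continuous_comp _ _ _ (fun p : 'rV[R]_n * R =>
  - sqn (p.1 - y) / (4 * (p.2 - s)) - n%:R / 2 * ln (p.2 - s)) expR);
  last exact: continuous_expR.
have c4 : {for p, continuous (fun p : 'rV[R]_n * R => 4 * (p.2 - s))}.
  exact: (continuousM (@cst_continuous _ _ (4 : R) p) c2).
have cs : {for p, continuous (fun p : 'rV[R]_n * R => - sqn (p.1 - y))}.
  exact: (continuousN (@sqn_fst_continuous _ _ y p)).
have cl : {for p, continuous (fun p : 'rV[R]_n * R => ln (p.2 - s))}.
  apply: (continuous_comp c2); exact: continuous_ln.
have cV : {for p, continuous (fun p : 'rV[R]_n * R => (4 * (p.2 - s))^-1)}.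
  by apply: (continuousV _ c4); rewrite mulf_neq0 ?gt_eqF.
exact: (continuousB (continuousM cs cV)
  (continuousM (@cst_continuous _ _ (n%:R / 2 : R) p) cl)).
Qed.

Lemma gauss_ge0 r (t : R) : 0 <= gauss n r t. Proof. exact: expR_ge0. Qed.

Lemma gauss_le (r t u : R) : 0 <= r -> 0 < t -> t <= u ->
  gauss n r u <= gauss n 0 t.
Proof.
move=> r0 t0 tu; rewrite ler_expR oppr0 mul0r sub0r -subr_ge0.
have u0 : 0 < u by apply: lt_le_trans tu.
have -> : - (n%:R / 2 * ln t) - (- r / (4 * u) - n%:R / 2 * ln u) =
  n%:R / 2 * (ln u - ln t) + r / (4 * u) by rewrite mulNr; ring.
rewrite addr_ge0//; last by rewrite divr_ge0// mulr_ge0// ltW.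
by rewrite mulr_ge0 ?divr_ge0// subr_ge0 ler_ln ?posrE.
Qed.

(** A kernel of age [d ^+ 2], seen from within one cell of side [d], is at least a dimensional
    constant divided by the volume of the cell. *)
Lemma gauss_ge (r d : R) : 0 < d -> r <= n%:R * d ^+ 2 ->
  expR (- (n%:R / 4)) / d ^+ n <= gauss n r (d ^+ 2).
Proof.
move=> d0 rn; rewrite /gauss.
have -> : d ^+ n = expR (n%:R / 2 * ln (d ^+ 2)).
  rewrite lnXn// (_ : _ * _ = n%:R * ln d); last by rewrite mulr2n; field.
  by rewrite expRM_natl lnK.
rewrite -expRN -expRD ler_expR lerD2r mulNr lerN2.
rewrite ler_pdivrMr ?mulr_gt0 ?exprn_gt0//.
by rewrite mulrA divfK.
Qed.

End gauss.

(** * Domination of a compactly supported function by heat kernels *)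

Section supersolution.
Context (R : realType) (n : nat).
Variables (h : 'rV[R]_n -> R) (L : R).
Hypothesis ch : continuous h.
Hypothesis hL : forall x, h x != 0 -> forall i, `|x ord0 i| < L.

(** The pairs of points of [K] whose values differ by at least [e] form a compact set [S], on which
    the distance attains a positive minimum unless [S] is empty. The cap [1] ensures that a close
    pair with differing values lies in [K]. *)
Lemma compact_support_unif_continuous (e : R) : 0 < e ->
  exists2 d, 0 < d & forall x y, `|x - y| < d -> `|h x - h y| < e.
Proof.
move=> e0.
pose K := [set x : 'rV[R]_n | sqn (x - 0) <= n%:R * (L + 1) ^+ 2].
pose S := (K `*` K) `&` [set p : 'rV[R]_n * 'rV[R]_n | e <= `|h p.1 - h p.2|].
have cS : compact S.
  apply: compact_closedI; first by apply: compact_setX; exact: compact_sqn_ball.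
  apply: (@preimage_closed _ _ (fun p : 'rV[R]_n * 'rV[R]_n => `|h p.1 - h p.2|)
    [set s | e <= s]); last exact: closed_ge.
  move=> p _; apply: (@continuous_comp _ _ _
    (fun p : 'rV[R]_n * 'rV[R]_n => h p.1 - h p.2) Num.Def.normr);
    last exact: norm_continuous.
  apply: (@continuousB _ _ _ (fun p : 'rV[R]_n * 'rV[R]_n => h p.1)
    (fun p => h p.2)).
    by apply: (@continuous_comp _ _ _ (@fst 'rV[R]_n 'rV[R]_n) h);
      [exact: cvg_fst|exact: ch].
  by apply: (@continuous_comp _ _ _ (@snd 'rV[R]_n 'rV[R]_n) h);
    [exact: cvg_snd|exact: ch].
have inK x y : h x != 0 -> `|x - y| < 1 -> K x /\ K y.
  move=> /hL xL xy; have xi i : `|x ord0 i| <= L + 1.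
    by rewrite (le_trans (ltW (xL i)))// lerDl.
  split; rewrite /K/= subr0; apply: sqn_le_norm => // i.
  rewrite (_ : y ord0 i = x ord0 i - (x - y) ord0 i); last by rewrite !mxE; ring.
  rewrite (le_trans (ler_normB _ _))// lerD//; first exact/ltW.
  exact: le_trans (coord_le_norm _ i) (ltW xy).
have inS x y : `|x - y| < 1 -> e <= `|h x - h y| -> S (x, y).
  move=> xy exy; split => //; have [hx|hx] := eqVneq (h x) 0; last first.
    by have [] := inK _ _ hx xy.
  have hy : h y != 0.
    apply: contraTneq exy => hy.
    by rewrite hx hy subrr normr0 -ltNge.
  by rewrite distrC in xy; have [] := inK _ _ hy xy.
have [[p0 Sp0]|S0] := pselect (exists p, S p); last first.
  exists 1 => // x y xy; rewrite ltNge; apply/negP => exy.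
  by apply: S0; exists (x, y); exact: inS.
have [|[x0 y0] /set_mem /= [_ /= exy0] pmin] :=
    @compact_EVT_min _ R (fun p : 'rV[R]_n * 'rV[R]_n => `|p.1 - p.2|) S
      (ex_intro _ _ Sp0) cS.
  apply: continuous_subspaceT => p.
  apply: (@continuous_comp _ _ _ (fun p : 'rV[R]_n * 'rV[R]_n => p.1 - p.2)
    Num.Def.normr); last exact: norm_continuous.
  exact: sub_continuous.
exists (Num.min 1 `|x0 - y0|).
  rewrite lt_min ltr01 normr_gt0 subr_eq0/=; apply: contraTneq exy0 => ->.
  by rewrite subrr normr0 -ltNge.
move=> x y; rewrite lt_min => /andP[xy1 xy]; rewrite ltNge; apply/negP => exy.
have := pmin (x, y) (mem_set (inS _ _ xy1 exy)).
by rewrite /= leNgt xy.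
Qed.

Hypothesis L0 : 0 < L.
Hypothesis h0 : forall x, 0 <= h x.
Variables (I e s : R).
Hypothesis hI : (\int[lebesgue_rV R n]_x (h x)%:E <= I%:E)%E.
Hypothesis e0 : 0 < e.

(* A superposition of heat kernels started slightly before time [s], one for
   each cell of a fine grid, weighted by the integral of [h] over the cell. *)
Lemma heat_supersolution : exists Z : 'rV[R]_n -> R -> R,
  [/\ forall x t, s <= t -> heat_at Z x t 0,
      forall p, s <= p.2 -> {for p, continuous (fun p => Z p.1 p.2)},
      forall x t, 0 <= Z x t,
      forall x, h x - e <= Z x s &
      forall x t, s < t -> Z x t <= expR (n%:R / 4) * gauss n 0 (t - s) * I].
Proof.
have [d0 d00 hd] := compact_support_unif_continuous e0.
(* [N.+1] cells per side make the cell side [d] smaller than the modulus of continuity [d0]. *)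
pose N := Num.truncn (2 * L / d0).
pose d := 2 * L / N.+1%:R.
have L20 : 0 < 2 * L by rewrite mulr_gt0.
have dd0 : d < d0.
  rewrite /d ltr_pdivrMr// [ltRHS]mulrC -ltr_pdivrMr//.
  by have /andP[] := truncn_itv (divr_ge0 (ltW L20) (ltW d00)).
have dp : 0 < d by rewrite divr_gt0.
pose c (k : {ffun 'I_n -> 'I_N.+1}) i := - L + (k i)%:R * d.
pose y k : 'rV[R]_n := \row_i c k i.
pose mu := lebesgue_rV R n.
pose J k := (\int[mu]_(x in cube (c k) d) (h x)%:E)%E.
have mh : measurable_fun setT (fun x => (h x)%:E).
  by apply/measurable_EFinP; exact: continuous_measurable_rV.
have mhD D : measurable_fun D (fun x => (h x)%:E).
  exact: measurable_funTS.
have JI : (\sum_k J k <= I%:E)%E.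
  apply: le_trans hI.
  rewrite -(@ge0_integral_bigsetU _ _ _ mu _ (fun k => cube (c k) d)
    (fun x => (h x)%:E) (index_enum _)).
  - apply: ge0_subset_integral => //.
    + by apply: bigsetU_measurable => k _; exact: measurable_cube.
    + by move=> x _; rewrite lee_fin.
  - by move=> k; exact: measurable_cube.
  - exact: index_enum_uniq.
  - move=> k l _ _ [x [xk xl]]; apply/ffunP => i; apply/val_inj/eqP.
    have := xk i; have := xl i; rewrite /c => /andP[l1 l2] /andP[k1 k2].
    have lt_kl (a b : nat) : - L + a%:R * d <= x ord0 i ->
        x ord0 i < - L + b%:R * d + d -> (a <= b)%N.
      move=> ax xb; rewrite -ltnS -(ltr_nat R) -(ltr_pM2r dp) mulrSr mulrDl mul1r.
      lra.
    by rewrite eqn_leq !lt_kl.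
  - exact: mhD.
  - by move=> x _; rewrite lee_fin.
have J0 k : (0 <= J k)%E by apply: integral_ge0 => x _; rewrite lee_fin.
have Jfin k : J k \is a fin_num.
  rewrite ge0_fin_numE//; apply: le_lt_trans (ltry I); apply: le_trans JI.
  by rewrite (bigD1 k)//= leeDl// sume_ge0.
pose a k := fine (J k).
have a0 k : 0 <= a k by exact: fine_ge0.
have aI : \sum_k a k <= I.
  rewrite -lee_fin -sumEFin; apply: le_trans JI; apply: lee_sum => k _.
  by rewrite fineK.
(* Compensates the loss [expR (- (n%:R / 4))] in [gauss_ge]. *)
pose C := expR (n%:R / 4 : R).
have C0 : 0 < C by exact: expR_gt0.
(* Starting at [s - d ^+ 2] gives every kernel the age [d ^+ 2] at time [s], matching its width to
   the cell side. *)
exists (fun x t => \sum_k (C * a k) * gauss n (sqn (x - y k)) (t - (s - d ^+ 2))).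
have d20 : 0 < d ^+ 2 by rewrite exprn_gt0.
have sd t : s <= t -> s - d ^+ 2 < t by lra.
split.
- move=> x t st; apply: heat_at_eq.
    apply: (@heat_at_sum _ _ _ _ _ (fun k => C * a k * 0 + 0 *
      gauss n (sqn (x - y k)) (t - (s - d ^+ 2)))) => k.
    apply: (@heat_at_scale _ _ (cst (C * a k)) 0).
    exact: heat_at_gauss (sd _ st).
  by rewrite big1// => k _; rewrite mulr0 mul0r addr0.
- move=> p sp; apply: cvg_big => [|k _]; first exact: add_continuous.
  apply: (@continuousM _ _ (cst (C * a k))
    (fun p : 'rV[R]_n * R => gauss n (sqn (p.1 - y k)) (p.2 - (s - d ^+ 2)))).
    exact: cst_continuous.
  exact/gauss_continuous/sd.
- move=> x t; apply: sumr_ge0 => k _.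
  by rewrite mulr_ge0 ?gauss_ge0// mulr_ge0// ltW.
- move=> x.
  set Z := \sum_k _.
  have Z0 : 0 <= Z.
    by apply: sumr_ge0 => k _; rewrite mulr_ge0 ?gauss_ge0// mulr_ge0// ltW.
  have [xe|ex] := leP (h x) e; first by apply: le_trans Z0; rewrite subr_le0.
  have xL i : `|x ord0 i| < L by apply: hL; rewrite gt_eqF// (lt_trans e0).
  (* The cell containing [x]. The default value of [inord] never occurs, since every coordinate of
     [x] is below [L]. *)
  pose k : {ffun 'I_n -> 'I_N.+1} :=
    [ffun i => inord (Num.truncn ((x ord0 i + L) / d))].
  have xk : cube (c k) d x.
    move=> i; rewrite /c ffunE; have := xL i; rewrite ltr_norml => /andP[x1 x2].
    have xi0 : 0 <= (x ord0 i + L) / d by rewrite divr_ge0 ?ltW// -(subrr L); lra.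
    have /andP[t1 t2] := truncn_itv xi0.
    rewrite inordK; last first.
      rewrite -(ltr_nat R) (le_lt_trans t1)// ltr_pdivrMr// /d.
      by rewrite mulrC divfK//; lra.
    move: t1 t2; set m := Num.truncn _; rewrite ler_pdivlMr// ltr_pdivrMr//.
    rewrite -natr1 mulrDl mul1r => t1 t2.
    by apply/andP; split; lra.
  have near_x z : cube (c k) d z -> h x - e <= h z.
    move=> zk; have : `|x - z| < d0.
      apply: le_lt_trans dd0; apply: norm_le_coord; first exact: ltW.
      move=> i; rewrite !mxE ler_norml; have := xk i; have := zk i.
      by move=> /andP[? ?] /andP[? ?]; apply/andP; split; lra.
    by move=> /hd; rewrite ltr_norml => /andP[_]; lra.
  (* On this cell [h] stays above [h x - e], so the kernel of the cell alone reaches [h x - e] at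
     [x]; the other kernels are nonnegative. *)
  have ak : (h x - e) * d ^+ n <= a k.
    rewrite -lee_fin fineK// EFinM -(lebesgue_cube (c k) dp).
    rewrite -integral_cst; last exact: measurable_cube.
    apply: ge0_le_integral => //.
    - exact: measurable_cube.
    - by move=> z _; rewrite lee_fin subr_ge0 ltW.
  rewrite /Z (bigD1 k)//= ler_wpDr//.
    by apply: sumr_ge0 => l _; rewrite mulr_ge0 ?gauss_ge0// mulr_ge0// ltW.
  rewrite subKr.
  have xyk : sqn (x - y k) <= n%:R * d ^+ 2.
    apply: sqn_le_norm => i; rewrite !mxE ger0_norm; have /andP[] := xk i; lra.
  apply: (@le_trans _ _ (C * a k * (expR (- (n%:R / 4)) / d ^+ n))); last first.
    by rewrite ler_wpM2l ?gauss_ge// mulr_ge0// ltW.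
  rewrite expRN -/C (_ : _ * _ = a k / d ^+ n); last first.
    by field; rewrite !gt_eqF ?exprn_gt0.
  by rewrite ler_pdivlMr// exprn_gt0.
- move=> x t st.
  apply: (@le_trans _ _ (\sum_k C * a k * gauss n 0 (t - s))).
    apply: ler_sum => k _; rewrite ler_wpM2l//; first by rewrite mulr_ge0// ltW.
    by apply: gauss_le; [exact: sqn_ge0|rewrite subr_gt0|lra].
  rewrite -mulr_suml -mulr_sumr mulrAC ler_pM2l//.
  by rewrite mulr_gt0// expR_gt0.
Qed.

End supersolution.

(** * Comparison from L^1 initial data *)

Lemma bounded_set_coord (R : realType) n (A : set 'rV[R]_n) : bounded_set A ->
  exists2 L : R, 0 < L & forall x, A x -> forall i, `|x ord0 i| < L.
Proof.
move=> /ex_strict_bound_gt0[L L0 AL]; exists L => // x Ax i.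
exact: le_lt_trans (coord_le_norm x i) (AL _ Ax).
Qed.

Lemma compact_closure (R : realType) n (A : set 'rV[R]_n) : bounded_set A ->
  compact (closure A).
Proof.
move=> /bounded_set_coord[L L0 AL].
have cK := @compact_sqn_ball R n 0 (n%:R * L ^+ 2).
apply: (subclosed_compact _ cK); first exact: closed_closure.
have Kcl : closed [set x : 'rV[R]_n | sqn (x - 0) <= n%:R * L ^+ 2].
  apply: compact_closed cK; exact: norm_hausdorff.
rewrite closureE => x; apply; split => // y Ay /=.
by rewrite subr0; apply: sqn_le_norm => i; apply/ltW/AL.
Qed.

Section comparison.
Context (R : realType) (n : nat).
Variables (Omega : set 'rV[R]_n) (w : 'rV[R]_n -> R -> R) (t0 K : R).
Hypothesis oO : open Omega.
Hypothesis bO : bounded_set Omega.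
Hypothesis cw : {within closure Omega `*` `]0, t0],
  continuous (fun p : 'rV[R]_n * R => w p.1 p.2)}.
Hypothesis w_boundary : forall x t, (closure Omega `\` Omega) x -> 0 < t <= t0 ->
  w x t = 0.
Hypothesis hw : forall x t, Omega x -> 0 < t <= t0 -> w x t < 0 ->
  exists2 c, K * w x t <= c & heat_at w x t c.

(** The extension by zero is continuous because [w] vanishes on the boundary: on the closure of
    [Omega] it agrees with [h1], which is continuous there. *)
Lemma negative_part_continuous (s : R) : 0 < s <= t0 ->
  continuous ((fun x => Num.max 0 (- w x s)) \_ Omega).
Proof.
move=> st; set h := _ \_ _; pose h1 x := Num.max 0 (- w x s).
have hE x : closure Omega x -> h x = h1 x.
  move=> clx; rewrite /h patchE; case: ifPn => // /negP; rewrite inE => nOx.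
  by rewrite /h1 w_boundary// oppr0 maxxx.
have h_out x : ~ Omega x -> h x = 0.
  by move=> nOx; rewrite /h patchE memNset.
have ch1 x e : closure Omega x -> 0 < e ->
    \forall y \near x, closure Omega y -> `|h1 x - h1 y| < e.
  move=> clx e0.
  have Dx : (closure Omega `*` `]0, t0]) (x, s) by split => //=; rewrite in_itv.
  have /subspace_continuousP/(_ _ Dx)/cvgr_dist_lt/(_ _ e0) := cw.
  rewrite /within/= => /nbhs_ballP[d /= d0 dP].
  apply/nbhs_ballP; exists d => // y xy cly.
  apply: le_lt_trans (dP (y, s) _ _); last by split => //=; rewrite in_itv.
    rewrite /h1 /=; set a := w x s; set b := w y s.
    have := ler_norm (a - b); have := ler_norm (b - a); rewrite (distrC b a) ler_norml.
    by case: (leP 0 (- a)) => ?; case: (leP 0 (- b)) => ? ? ?; apply/andP; lra.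
  by split => //=; exact: ballxx.
move=> x; apply/(@cvgrPdist_lt _ _ _ (nbhs (x : 'rV[R]_n)) (nbhs_filter x) h (h x)) => e e0.
have [Ox|nOx] := pselect (Omega x).
  have clx : closure Omega x by exact: subset_closure.
  have := ch1 _ _ clx e0; have := open_nbhs_nbhs (conj oO Ox).
  apply: filterS2 => y Oy; rewrite !hE//; last exact: subset_closure.
  by apply; exact: subset_closure.
have [clx|nclx] := pselect (closure Omega x).
  apply: filterS (ch1 _ _ clx e0) => y H.
  have [Oy|nOy] := pselect (Omega y); last by rewrite !h_out// subrr normr0.
  have cly : closure Omega y by exact: subset_closure.
  by rewrite !hE//; exact: H.
have : nbhs x (~` closure Omega).
  by apply: open_nbhs_nbhs; split => //; exact/closed_openC/closed_closure.
apply: filterS => y ncly; rewrite !h_out// ?subrr ?normr0//.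
by move=> /subset_closure.
Qed.

(** The weight [expR (- K * (t - s))] absorbs the zero-order term: where [w] is negative, the
    weighted [w] is a supersolution of the heat equation. The minimum principle is applied to its
    sum with the heat-kernel supersolution and a small linear term. *)
Lemma L1_to_pointwise (s I e : R) (x : 'rV[R]_n) : 0 < s < t0 -> 0 < e ->
  (\int[lebesgue_rV R n]_(x in Omega) (Num.max 0 (- w x s))%:E <= I%:E)%E ->
  Omega x -> - (expR (- K * (t0 - s)) * w x t0) <=
    expR (n%:R / 4) * gauss n 0 (t0 - s) * I + e * (1 + (t0 - s)).
Proof.
move=> /andP[s0 st0] e0 hI Ox.
have st : 0 < s <= t0 by rewrite s0 ltW.
have ch := negative_part_continuous st; set h := _ \_ _ in ch.
have [L L0 OL] := bounded_set_coord bO.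
have hL y : h y != 0 -> forall i, `|y ord0 i| < L.
  rewrite /h patchE; case: ifPn => [/set_mem/OL//|_].
  by rewrite eqxx.
have h0 y : 0 <= h y.
  by rewrite /h patchE; case: ifPn => // _; rewrite le_max lexx.
have hI' : (\int[lebesgue_rV R n]_y (h y)%:E <= I%:E)%E.
  move: hI; rewrite integral_mkcond.
  rewrite (_ : _ \_ _ = fun y => (h y)%:E)//.
  by rewrite (restrict_EFin (fun y => Num.max 0 (- w y s)) Omega).
have [Z [heatZ contZ Z0 Zs Zt]] := heat_supersolution ch hL L0 h0 s hI' e0.
pose p t := expR (- K * (t - s)).
have dp (t : R) : is_derive t 1 p (- K * p t).
  have d1 : is_derive t 1 (fun t => - K * (t - s)) (- K).
    by apply: (@is_derive_quadratic _ _ (K * s) (- K) 0) => [u|]; ring.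
  by rewrite mulrC; apply: (@is_derive1_comp _ expR (fun t => - K * (t - s))).
have p0 t : 0 < p t by exact: expR_gt0.
(* The last term plays two roles: its time derivative [e] makes the inequality strict, and its value
   [e] at time [s] covers the error in [Zs]. *)
pose q y t := p t * w y t + (Z y t + e * (1 + (t - s))).
suff : 0 <= q x t0 by rewrite /q /p; have := Zt x _ st0; lra.
pose D := closure Omega `*` `[s, t0]%classic.
apply: (@heat_min_principle _ _ D); last first.
- by split => /=; [exact: subset_closure|rewrite in_itv/= lexx ltW].
- move=> y t [/= cly]; rewrite in_itv/= => /andP[s_t t_t0] qyt.
  have t00 : 0 < t <= t0 by rewrite t_t0 (lt_le_trans s0).
  have et : 0 < e * (1 + (t - s)) by rewrite mulr_gt0//; lra.
  have wyt : w y t < 0.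
    rewrite ltNge; apply/negP => wyt.
    have : 0 <= p t * w y t by rewrite mulr_ge0// ltW.
    by have := Z0 y t; move: qyt; rewrite /q; lra.
  have Oy : Omega y.
    apply: contrapT => nOy; move: wyt.
    by rewrite w_boundary ?ltxx.
  have st' : s < t.
    rewrite lt_neqAle s_t andbT; apply/eqP => Es; move: qyt wyt.
    rewrite -Es /q /p subrr mulr0 expR0 mul1r addr0 mulr1 => qys wys.
    have := Zs y; rewrite /h patchE mem_set//.
    have : - w y s <= Num.max 0 (- w y s) by rewrite le_max lexx orbT.
    lra.
  split.
    have [c Kc hc] := hw Oy t00 wyt.
    have hlin : heat_at (fun _ t => e * (1 + (t - s))) y t e.
      by apply: heat_at_time; apply: (@is_derive_quadratic _ _ (e * (1 - s)) e 0)
        => [u|]; ring.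
    have := heat_at_add (heat_at_scale (dp t) hc)
      (heat_at_add (heatZ y t s_t) hlin).
    set c' := _ + _ => hq; exists c' => //.
    have : 0 <= p t * (c - K * w y t) by rewrite mulr_ge0 ?subr_ge0// ltW.
    rewrite /c'; lra.
  near=> z => zt; rewrite [z]surjective_pairing; split => /=.
    apply: subset_closure; near: z.
    have : \forall z \near (y, t), Omega z.1.
      by apply: (@cvg_fst _ _ (nbhs y) (nbhs t)); exact: open_nbhs_nbhs.
    by [].
  rewrite in_itv/=; apply/andP; split; last exact: le_trans t_t0.
  by near: z; apply: cvgr_ge (@cvg_snd _ _ _ _ _) _ st'.
- apply: within_continuousD.
    have cw' : {within D, continuous (fun z : 'rV[R]_n * R => w z.1 z.2)}.
      apply: continuous_subspaceW cw => -[y t] [/= cly]; rewrite !in_itv/=.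
      by move=> /andP[s_t ->]; split => //=; rewrite andbT (lt_le_trans s0).
    move=> z; apply: (@continuousM _ _ (fun z : subspace D => p (z : 'rV[R]_n * R).2)
      (fun z : subspace D => w (z : 'rV[R]_n * R).1 (z : 'rV[R]_n * R).2));
      last exact: cw'.
    apply: (@continuous_subspaceT _ _ D (fun z : 'rV[R]_n * R => p z.2)) => {}z.
    apply: (@continuous_comp _ _ _ (@snd 'rV[R]_n R) p); first exact: cvg_snd.
    by apply/differentiable_continuous/derivable1_diffP; apply: ex_derive.
  apply: continuous_in_subspaceT => -[y t]; rewrite inE => -[/= _].
  rewrite in_itv/= => /andP[s_t _].
  apply: (@continuousD _ _ _ (fun z : 'rV[R]_n * R => Z z.1 z.2)
    (fun z => e * (1 + (z.2 - s)))); first exact: contZ.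
  apply: (@continuous_comp _ _ _ (@snd 'rV[R]_n R) (fun t => e * (1 + (t - s))));
    first exact: cvg_snd.
  have d1 : is_derive t 1 (fun t => e * (1 + (t - s))) e.
    by apply: (@is_derive_quadratic _ _ (e * (1 - s)) e 0) => [u|]; ring.
  by apply/differentiable_continuous/derivable1_diffP; apply: ex_derive.
- apply: compact_setX; [exact: compact_closure|exact: segment_compact].
Unshelve. all: by end_near.
Qed.

Hypothesis t00 : 0 < t0.
Hypothesis K0 : 0 <= K.
Hypothesis small_initial : forall e d : R, 0 < e -> 0 < d ->
  exists2 s, 0 < s < d &
    (\int[lebesgue_rV R n]_(x in Omega) (Num.max 0 (- w x s))%:E <= e%:E)%E.

Lemma nonneg_of_initial x : Omega x -> 0 <= w x t0.
Proof.
move=> Ox; rewrite leNgt; apply/negP => wx.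
pose E := expR (K * t0); pose G := expR (n%:R / 4) * gauss n 0 (t0 / 2).
have E0 : 0 < E by exact: expR_gt0.
have G0 : 0 <= G by rewrite mulr_ge0 ?gauss_ge0// expR_ge0.
(* Both error terms will be at most [m], and undoing the exponential weight costs at most a factor
   [E]; so [- w x t0 <= 2 * E * m], which is half of [- w x t0]. Taking [s < t0 / 2] bounds the
   kernel by [G] uniformly in [s]. *)
pose m := - w x t0 / (4 * E).
have m0 : 0 < m by rewrite divr_gt0 ?oppr_gt0// mulr_gt0.
have e0 : 0 < m / (1 + t0) by rewrite divr_gt0// addr_gt0.
have i0 : 0 < m / (1 + G) by rewrite divr_gt0// ltr_pwDl.
have [s /andP[s0 st] hs] := small_initial i0 (divr_gt0 t00 (ltr0Sn R 1)).
have t2 : t0 / 2 <= t0 - s by lra.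
have st0 : 0 < s < t0 by rewrite s0; move: t00; lra.
have := L1_to_pointwise st0 e0 hs Ox.
have : G * (m / (1 + G)) <= m.
  by rewrite mulrCA ler_piMr ?(ltW m0)// ler_pdivrMr ?mul1r ?lerDr// ltr_pwDl.
have : m / (1 + t0) * (1 + (t0 - s)) <= m.
  rewrite -mulrA ler_piMr ?(ltW m0)// mulrC ler_pdivrMr ?mul1r; first lra.
  by rewrite addr_gt0.
have : expR (n%:R / 4) * gauss n 0 (t0 - s) * (m / (1 + G)) <= G * (m / (1 + G)).
  rewrite ler_wpM2r ?(ltW i0)// ler_wpM2l ?expR_ge0//.
  by apply: gauss_le => //; rewrite divr_gt0.
have : - w x t0 <= E * - (expR (- K * (t0 - s)) * w x t0).
  rewrite -mulrN mulrA ler_peMl ?oppr_ge0 ?(ltW wx)//.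
  rewrite -expRD -[leLHS]expR0 ler_expR.
  rewrite (_ : _ + _ = K * s); last by ring.
  by rewrite mulr_ge0// ltW.
have : 4 * (E * m) = - w x t0 by rewrite /m; field; rewrite gt_eqF.
set W := - (_ * _); set A := _ * _ * (m / _); set B := _ * (1 + _).
move=> mE EW A1 B1 A2 WAB.
have : E * W <= E * (2 * m) by rewrite ler_pM2l//; lra.
have : 0 < E * m by rewrite mulr_gt0.
lra.
Qed.

End comparison.

(** * The semilinear problem *)

(** The derivative $-g'/g^2$ of [1/g] is nonnegative and continuous on [[m, b]]; its maximum there
    is the constant, by the mean value theorem. *)
Lemma reciprocal_lipschitz (R : realType) (g : R -> R) (m b : R) :
  (forall s, s < 1 -> 0 < g s) -> C2_lt1 g ->
  (forall s, s < 1 -> derive1 g s <= 0) -> m <= b -> b < 1 ->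
  exists2 K, 0 <= K & forall r s, m <= r -> r <= s -> s <= b ->
    0 <= (g s)^-1 - (g r)^-1 <= K * (s - r).
Proof.
move=> g0 gC2 g'0 mb b1.
pose k x := - (g x) ^- 2 * derive1 g x.
have dg (x : R) : x < 1 -> is_derive x 1 (fun s => (g s)^-1) (k x).
  move=> x1; have [dgx _ _] := gC2 _ x1.
  have gx0 : g x != 0 by rewrite gt_eqF// g0.
  by rewrite /k derive1E; exact: (is_deriveV gx0 (derivableP dgx)).
have k0 x : x < 1 -> 0 <= k x.
  by move=> x1; rewrite /k mulNr oppr_ge0 mulr_ge0_le0 ?invr_ge0 ?sqr_ge0// g'0.
have ck : {within `[m, b], continuous k}.
  apply: derivable_within_continuous => x; rewrite in_itv/= => /andP[_ xb].
  have x1 : x < 1 by exact: le_lt_trans b1.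
  have [dgx ddgx _] := gC2 _ x1.
  have gx0 : g x != 0 by rewrite gt_eqF// g0.
  apply: derivableM => //; apply: derivableN.
  have -> : (fun s => g s ^- 2) = (fun s => (g s)^-1) * (fun s => (g s)^-1).
    by apply/funext => s; rewrite -exprVn.
  by apply: derivableM; exact: derivableV.
have [c cmb kmax] := EVT_max mb ck.
have c1 : c < 1.
  by move: cmb; rewrite in_itv/= => /andP[_ cb]; exact: le_lt_trans b1.
exists (k c); first exact: k0.
move=> r s mr rs sb.
have [|| z] := @MVT_segment _ (fun s => (g s)^-1) k r s rs.
- move=> z; rewrite in_itv/= => /andP[_ zs]; apply: dg.
  by rewrite (lt_le_trans zs)// (le_trans sb)// ltW.
- apply: derivable_within_continuous => z; rewrite in_itv/= => /andP[_ zs].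
  by apply: ex_derive; apply: dg; rewrite (le_lt_trans zs)// (le_lt_trans sb).
rewrite in_itv/= => /andP[rz zs] ->; rewrite mulr_ge0 ?subr_ge0//=; last first.
  by apply: k0; rewrite (le_lt_trans zs)// (le_lt_trans sb).
rewrite ler_wpM2r ?subr_ge0//; apply: kmax.
by rewrite in_itv/= (le_trans mr)//= (le_trans zs).
Qed.

Lemma hoelder_on_bounded (R : realType) n (D : set 'rV[R]_n) (alpha : R)
    (f : 'rV[R]_n -> R) : 0 <= alpha -> compact D -> hoelder_on D alpha f ->
  exists2 F, 0 <= F & forall x, D x -> f x <= F.
Proof.
move=> a0 /compact_bounded/ex_strict_bound_gt0[M M0 DM] [C fC].
have [[x0 Dx0]|nD] := pselect (exists x, D x); last first.
  by exists 0 => // x Dx; exfalso; apply: nD; exists x.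
(* [M + M] bounds the diameter of [D]; the absolute value is taken because [C] may have any sign. *)
exists (`|f x0| + `|C| * (M + M) `^ alpha).
  by rewrite addr_ge0// mulr_ge0// powR_ge0.
move=> x Dx; rewrite -[f x](subrK (f x0)) addrC lerD ?ler_norm//.
apply: (le_trans (ler_norm _)); apply: (le_trans (fC _ _ Dx Dx0)).
apply: (@le_trans _ _ (`|C| * `|x - x0| `^ alpha)).
  by rewrite ler_wpM2r ?powR_ge0// ler_norm.
rewrite ler_wpM2l// ge0_ler_powR ?nnegrE ?addr_ge0 ?(ltW M0)//.
by rewrite (le_trans (ler_normB _ _))// lerD// ltW//; exact: DM.
Qed.

Lemma open_continuous_measurable_rV (R : realType) n (D : set 'rV[R]_n)
    (f : 'rV[R]_n -> R) : open D -> (forall x, D x -> {for x, continuous f}) ->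
  measurable_fun D f.
Proof.
move=> oD cf; apply: (measurability _ (RGenOpens.measurableE R)).
move=> _ [_ [a [b ->] <-]].
have oI : open `]a, b[%classic by exact: interval_open.
suff oU : open (D `&` f @^-1` `]a, b[ : set 'rV[R]_n) by exact: open_measurable_rV.
rewrite openE => x [Dx fx].
have := cf _ Dx _ (open_nbhs_nbhs (conj oI fx)).
by have := open_nbhs_nbhs (conj oD Dx); apply: filterS2 => y Dy fy; split.
Qed.

Lemma solution_upper_bound (R : realType) n (D : set ('rV[R]_n * R))
    (u : 'rV[R]_n -> R -> R) :
  (ereal_sup [set (u p.1 p.2)%:E | p in D] < 1)%E ->
  exists2 b : R, b < 1 & forall x t, D (x, t) -> u x t <= b.
Proof.
set S := [set _ | _ in _] => S1.
have uS x t : D (x, t) -> ((u x t)%:E <= ereal_sup S)%E.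
  by move=> Dxt; apply: ereal_sup_ubound; exists (x, t).
case: (ereal_sup S) S1 uS => [b| |] b1 uS.
- by exists b; [rewrite -lte_fin|move=> x t /uS; rewrite lee_fin].
- by [].
(* Here the supremum is $-\infty$, so [D] is empty and any bound below [1] serves. *)
- by exists 0 => // x t /uS; rewrite leeNy_eq.
Qed.

(** * The difference of two solutions *)

Section solutions.
Context (R : realType) (n : nat) (Omega : set 'rV[R]_n) (lambda T alpha a : R)
  (f : 'rV[R]_n -> R) (g : R -> R) (u01 u02 : 'rV[R]_n -> R)
  (u1 u2 : 'rV[R]_n -> R -> R).
Let mu := lebesgue_rV R n.
Hypothesis bounded_domain : bounded_C2_domain Omega.
Hypothesis lambda0 : 0 <= lambda.
Hypothesis T0 : 0 < T.
Hypothesis alpha01 : 0 < alpha < 1.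
Hypothesis f_hoelder : hoelder_on (closure Omega) alpha f.
Hypothesis f0 : forall x, closure Omega x -> 0 <= f x.
Hypothesis g0 : forall s, s < 1 -> 0 < g s.
Hypothesis gC2 : C2_lt1 g.
Hypothesis g'0 : forall s, s < 1 -> derive1 g s <= 0.
Hypothesis u01_Linfty : Linfty Omega u01.
Hypothesis u02_Linfty : Linfty Omega u02.
Hypothesis u0_le : {ae mu, forall x, Omega x -> u01 x <= u02 x <= a}.
Hypothesis sol1 : solution_P Omega lambda f g T u01 u1.
Hypothesis bounded1 : bounded_on_cylinder Omega T u1.
Hypothesis sol2 : solution_P Omega lambda f g T u02 u2.
Hypothesis bounded2 : bounded_on_cylinder Omega T u2.

Let oO : open Omega. Proof. by case: bounded_domain. Qed.
Let cO : connected Omega. Proof. by case: bounded_domain. Qed.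
Let bO : bounded_set Omega. Proof. by case: bounded_domain. Qed.
Let mO : measurable Omega. Proof. exact: open_measurable_rV. Qed.

Let w x t := u2 x t - u1 x t.

Let continuous_solution u0 u x t : solution_P Omega lambda f g T u0 u ->
  Omega x -> 0 < t < T ->
  {for (x, t), continuous (fun p : 'rV[R]_n * R => u p.1 p.2)}.
Proof.
by move=> [[C21 _] _ _ _ _] Ox tT; have [] := C21 x t; first split.
Qed.

Let measurable_solution u0 u t : solution_P Omega lambda f g T u0 u ->
  0 < t < T -> measurable_fun Omega (u ^~ t).
Proof.
move=> sol tT; apply: open_continuous_measurable_rV => // x Ox.
apply: (@continuous_comp _ _ _ (fun y => (y, t)) (fun p => u p.1 p.2) x).
  exact: (@cvg_pair _ _ _ _ _ _ (nbhs_filter x) (nbhs_filter x) (nbhs_filter t)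
    id (cst t) cvg_id (@cvg_cst _ t _ _ (nbhs_filter x))).
exact: (continuous_solution sol Ox tT).
Qed.

Lemma heat_at_difference x t : Omega x -> 0 < t < T ->
  heat_at w x t (lambda * f x * ((g (u2 x t))^-1 - (g (u1 x t))^-1)).
Proof.
move=> Ox tT.
have oI : open `]0, T[%classic by exact: interval_open.
have oQ : open (Omega `*` `]0, T[).
  rewrite openE => -[y s] [/= Oy sT].
  exists (Omega, `]0, T[%classic); last by [].
  by split => /=; apply: open_nbhs_nbhs; split.
have Qxt : (Omega `*` `]0, T[) (x, t) by split => //=; rewrite in_itv.
have [[C1 _] E1 _ _ _] := sol1; have [[C2 _] E2 _ _ _] := sol2.
have h1 := C21_heat_at oQ C1 Qxt; have h2 := C21_heat_at oQ C2 Qxt.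
rewrite E1// in h1; rewrite E2// in h2.
have -> : w = fun y s => u2 y s + cst (-1) s * u1 y s.
  by apply/funext => y; apply/funext => s; rewrite /w /= mulN1r.
apply: heat_at_eq
  (heat_at_add h2 (heat_at_scale (is_derive_cst (-1 : R) t 1) h1)) _.
rewrite /=; ring.
Qed.

(** Up to time [t0] both solutions take values in a fixed interval [[m, b]] with [b < 1]. There
    monotonicity of [1/g] gives the sign of [c], and its Lipschitz bound, with an upper bound for
    [f], gives the linear estimate. *)
Lemma difference_reaction_bound t0 : 0 < t0 < T -> exists2 K, 0 <= K &
  forall x t, Omega x -> 0 < t <= t0 ->
    let c := lambda * f x * ((g (u2 x t))^-1 - (g (u1 x t))^-1) in
    (0 <= w x t -> 0 <= c) /\ (w x t < 0 -> K * w x t <= c).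
Proof.
move=> /andP[t00 t0T].
have t0T' : 0 < t0 < T by rewrite t00.
have [_ _ _ /(_ _ t0T')/solution_upper_bound[b1 b11 ub1] _] := sol1.
have [_ _ _ /(_ _ t0T')/solution_upper_bound[b2 b21 ub2] _] := sol2.
have [M1 lb1] := bounded1; have [M2 lb2] := bounded2.
(* Including [b] in the minimum guarantees [m <= b]. *)
pose b := Num.max b1 b2; pose m := Num.min b (Num.min (- M1) (- M2)).
have b1' : b < 1 by rewrite gt_max b11.
have mb : m <= b by rewrite ge_min lexx.
have [Kg Kg0 Kg_lip] := reciprocal_lipschitz g0 gC2 g'0 mb b1'.
have [F F0 fF] := hoelder_on_bounded (ltW (proj1 (andP alpha01)))
  (compact_closure bO) f_hoelder.
exists (lambda * F * Kg); first by rewrite !mulr_ge0.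
move=> x t Ox /andP[t0' tt0] c.
have tT : 0 < t < T by rewrite t0' (le_lt_trans tt0).
have clx : closure Omega x by exact: subset_closure.
have Dxt : (closure Omega `*` `]0, t0]) (x, t).
  by split => //=; rewrite in_itv/= t0'.
have ub1x : u1 x t <= b by rewrite le_max ub1.
have ub2x : u2 x t <= b by rewrite le_max ub2 ?orbT.
have lb1x : m <= u1 x t.
  have := lb1 _ _ Ox tT; rewrite ler_norml => /andP[+ _].
  by apply: le_trans; rewrite !ge_min lexx !orbT.
have lb2x : m <= u2 x t.
  have := lb2 _ _ Ox tT; rewrite ler_norml => /andP[+ _].
  by apply: le_trans; rewrite !ge_min lexx !orbT.
have lf0 : 0 <= lambda * f x by rewrite mulr_ge0// f0.
split=> [w0|w0].
  have u12 : u1 x t <= u2 x t by rewrite -subr_ge0.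
  by have /andP[k0 _] := Kg_lip _ _ lb1x u12 ub2x; rewrite mulr_ge0.
have u21 : u2 x t <= u1 x t by move: w0; rewrite /w; lra.
have /andP[k0 k1] := Kg_lip _ _ lb2x u21 ub1x.
rewrite /c -(opprB (g (u1 x t))^-1) mulrN -lerN2 opprK -mulrN -mulrA /w opprB.
apply: (@le_trans _ _ (lambda * f x * (Kg * (u1 x t - u2 x t)))).
  by rewrite ler_wpM2l.
rewrite -!mulrA ler_wpM2l// ler_wpM2r ?fF// mulr_ge0// subr_ge0//.
Qed.

(** The order of the initial values holds only almost everywhere, hence the conditional pointwise
    bound on [F]. It is applied to the negative part of [w] and to the distance between the initial
    values. *)
Lemma integral_initial_layer (t e : R) (F : 'rV[R]_n -> R) : 0 < t < T ->
  measurable_fun Omega F -> (forall x, 0 <= F x) ->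
  (forall x, Omega x -> u01 x <= u02 x ->
    F x <= `|u1 x t - u01 x| + `|u2 x t - u02 x|) ->
  (\int[mu]_(x in Omega) (`|u1 x t - u01 x|)%:E < (e / 2)%:E)%E ->
  (\int[mu]_(x in Omega) (`|u2 x t - u02 x|)%:E < (e / 2)%:E)%E ->
  (\int[mu]_(x in Omega) (F x)%:E <= e%:E)%E.
Proof.
move=> tT mF F0 Fle i1 i2.
have mD (v : 'rV[R]_n -> R -> R) (v0 : 'rV[R]_n -> R) :
    solution_P Omega lambda f g T v0 v -> Linfty Omega v0 ->
    measurable_fun Omega (fun x => (`|v x t - v0 x|)%:E).
  move=> sol [mv0 _]; apply/measurable_EFinP.
  apply: (measurableT_comp (@normr_measurable R setT)).
  by apply: measurable_funB => //; exact: measurable_solution sol tT.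
have m1 := mD _ _ sol1 u01_Linfty; have m2 := mD _ _ sol2 u02_Linfty.
apply: (@le_trans _ _ (\int[mu]_(x in Omega)
  ((`|u1 x t - u01 x|)%:E + (`|u2 x t - u02 x|)%:E))%E).
  apply: ae_ge0_le_integral => //.
  - by move=> x _; rewrite lee_fin.
  - exact/measurable_EFinP.
  - by move=> x _; rewrite adde_ge0// lee_fin.
  - exact: emeasurable_funD.
  - apply: filterS u0_le => x u0x Ox; rewrite -EFinD lee_fin.
    by have /andP[u0x' _] := u0x Ox; exact: Fle.
rewrite ge0_integralD//; [|by move=> x _; rewrite lee_fin..].
by rewrite (splitr e) EFinD leeD// ltW.
Qed.

Lemma initial_layer (e d : R) : 0 < e -> 0 < d -> exists2 s, 0 < s < d &
  (\int[mu]_(x in Omega) (`|u1 x s - u01 x|)%:E < e%:E)%E /\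
  (\int[mu]_(x in Omega) (`|u2 x s - u02 x|)%:E < e%:E)%E.
Proof.
move=> e0 d0; have e0' : (0 < e%:E)%E by rewrite lte_fin.
have [_ _ _ _ c1] := sol1; have [_ _ _ _ c2] := sol2.
have n1 : \forall s \near (0 : R)^'+,
    (\int[mu]_(x in Omega) (`|u1 x s - u01 x|)%:E < e%:E)%E.
  exact: c1 _ (open_ereal_lt' e0').
have n2 : \forall s \near (0 : R)^'+,
    (\int[mu]_(x in Omega) (`|u2 x s - u02 x|)%:E < e%:E)%E.
  exact: c2 _ (open_ereal_lt' e0').
near (0 : R)^'+ => s; exists s; last by split; near: s.
by apply/andP; split; near: s; [exact: nbhs_right_gt|exact: nbhs_right_lt].
Unshelve. all: by end_near.
Qed.

Lemma difference_ge0 x t : Omega x -> 0 < t < T -> 0 <= w x t.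
Proof.
move=> Ox tT; have /andP[t0 tT'] := tT.
have [K K0 Kw] := difference_reaction_bound tT.
have [[_ cu1] _ b1 _ _] := sol1; have [[_ cu2] _ b2 _ _] := sol2.
apply: (@nonneg_of_initial R n Omega w t K) => //.
- apply: (@continuous_subspaceW _ _ _ (closure Omega `*` `]0, T[)).
    move=> [y s] [/= cly]; rewrite !in_itv/= => /andP[s0 st]; split => //=.
    by rewrite s0 (le_lt_trans st).
  exact: within_continuousB.
- move=> y s yO /andP[s0 st]; have sT : 0 < s < T by rewrite s0 (le_lt_trans st).
  by rewrite /w b1// b2// subrr.
- move=> y s Oy st wys; have [_ /(_ wys) Kc] := Kw _ _ Oy st.
  eexists; first exact: Kc.
  by apply: heat_at_difference => //; case/andP: st => -> /le_lt_trans ->.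
- move=> e d e0 d0.
  have dT0 : 0 < Num.min d T by rewrite lt_min d0.
  have [s /andP[s0 sd] [i1 i2]] := initial_layer (divr_gt0 e0 (ltr0Sn R 1)) dT0.
  move: sd; rewrite lt_min => /andP[sd sT].
  have sT' : 0 < s < T by rewrite s0.
  exists s; first by rewrite s0.
  apply: integral_initial_layer i1 i2 => //.
  + apply: measurable_maxr => //; apply: measurableT_comp => //.
    by apply: measurable_funB; [exact: measurable_solution sol2 sT'|
      exact: measurable_solution sol1 sT'].
  + by move=> y; rewrite le_max lexx.
  (* The negative part is controlled by writing [u1 - u2] as
     [(u1 - u01) + (u01 - u02) + (u02 - u2)], whose middle term is nonpositive. *)
  + move=> y Oy u0y; rewrite ge_max addr_ge0//= /w.
    have := ler_norm (u1 y s - u01 y); have := ler_norm (- (u2 y s - u02 y)).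
    by rewrite normrN; lra.
Qed.

(** Otherwise [u1] and [u2] coincide at all times before [t]; both initial values are then $L^1$
    limits of the same functions, so they agree almost everywhere. *)
Lemma difference_gt0_somewhere t : 0 < t < T ->
  (0 < mu (Omega `&` [set x | u01 x != u02 x]))%E ->
  exists x s, [/\ Omega x, 0 < s < t & 0 < w x s].
Proof.
move=> /andP[t0 tT] mu0; apply: contrapT => nw.
have w0 x s : Omega x -> 0 < s < t -> w x s = 0.
  move=> Ox st; have sT : 0 < s < T by case/andP: st => -> /lt_trans ->.
  apply/eqP; rewrite eq_le difference_ge0// andbT leNgt; apply/negP => wxs.
  by apply: nw; exists x, s.
have mu12 : measurable_fun Omega (fun x => `|u02 x - u01 x|).
  have [m1 _] := u01_Linfty; have [m2 _] := u02_Linfty.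
  apply: (measurableT_comp (@normr_measurable R setT)).
  exact: measurable_funB.
have I0 : (\int[mu]_(x in Omega) (`|u02 x - u01 x|)%:E = 0)%E.
  apply/eqP; rewrite eq_le; apply/andP; split; last first.
    by apply: integral_ge0 => x _; rewrite lee_fin.
  apply/lee_addgt0Pr => e e0; rewrite add0e.
  have [s /andP[s0 st] [i1 i2]] := initial_layer (divr_gt0 e0 (ltr0Sn R 1)) t0.
  apply: integral_initial_layer i1 i2 => //.
    by rewrite s0 (lt_trans st).
  move=> x Ox _; have : w x s = 0 by apply: w0; rewrite ?s0.
  rewrite /w => /eqP; rewrite subr_eq0 => /eqP ->.
  rewrite (_ : u02 x - u01 x = (u1 x s - u01 x) - (u1 x s - u02 x)); last by ring.
  exact: ler_normB.
have I0' : (\int[mu]_(x in Omega) `|(`|u02 x - u01 x|)%:E| = 0)%E.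
  by rewrite -[RHS]I0; apply: eq_integral => x _; rewrite /= normr_id.
have ae0 := (ae_eq_integral_abs mu mO (proj2 (measurable_EFinP _ _) mu12)).1 I0'.
(* Measurability is what turns negligibility of this set into measure zero. *)
have mS : measurable (Omega `&` [set x | u01 x != u02 x]).
  rewrite (_ : _ `&` _ = Omega `&` (fun x => `|u02 x - u01 x|) @^-1` (~` [set 0])).
    by apply: mu12 => //; exact: measurableC.
  apply/seteqP; split => x [Ox /= H]; split => //=.
    by move/eqP; rewrite normr_eq0 subr_eq0 eq_sym; exact/negP.
  by apply/eqP => E; apply: H; rewrite E subrr normr0.
have : mu (Omega `&` [set x | u01 x != u02 x]) = 0%E.
  apply/negligibleP => //; apply: negligibleS ae0 => x [Ox /= u12] /=.
  move=> /(_ Ox) [/eqP]; rewrite normr_eq0 subr_eq0 eq_sym.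
  exact/negP.
by move=> E; rewrite E ltxx in mu0.
Qed.

Lemma difference_gt0 x t : Omega x -> 0 < t < T ->
  (0 < mu (Omega `&` [set x | u01 x != u02 x]))%E -> 0 < w x t.
Proof.
move=> Ox tT mu0; have /andP[t0 tT'] := tT.
have [x1 [s [Ox1 /andP[s0 st] ws]]] := difference_gt0_somewhere tT mu0.
have sT : 0 < s < T by rewrite s0 (lt_trans st).
apply: (@strong_positivity R n Omega T w _ _ _ x1 s) => //; last by rewrite st.
- move=> y r Oy rT; apply: (@continuousB _ _ _ (fun p : 'rV[R]_n * R => u2 p.1 p.2)
    (fun p => u1 p.1 p.2)); first exact: continuous_solution sol2 Oy rT.
  exact: continuous_solution sol1 Oy rT.
- by move=> y r Oy rT; exact: difference_ge0.
- move=> y r Oy rT; have [K _ Kw] := difference_reaction_bound rT.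
  have rr : 0 < r <= r by case/andP: rT => ->; rewrite lexx.
  have [/(_ (difference_ge0 Oy rT)) c0 _] := Kw _ _ Oy rr.
  eexists; first exact: c0.
  exact: heat_at_difference.
Qed.

End solutions.

Unset Implicit Arguments.

Theorem corollary2p7 (R : realType) (n : nat) (Omega : set 'rV[R]_n)
    (lambda T alpha a : R) (f : 'rV[R]_n -> R) (g : R -> R)
    (u01 u02 : 'rV[R]_n -> R) (u1 u2 : 'rV[R]_n -> R -> R) :
  (0 < n)%N -> bounded_C2_domain Omega ->
  0 <= lambda -> 0 < T ->
  0 < alpha < 1 -> hoelder_on (closure Omega) alpha f ->
  (forall x, closure Omega x -> 0 <= f x) ->
  (exists2 x, closure Omega x & f x != 0) ->
  (forall s, s < 1 -> 0 < g s) -> C2_lt1 g ->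
  (forall s, s < 1 -> derive1 g s <= 0) ->
  Linfty Omega u01 -> Linfty Omega u02 ->
  0 < a < 1 ->
  {ae lebesgue_rV R n, forall x, Omega x -> u01 x <= u02 x <= a} ->
  (0 < lebesgue_rV R n (Omega `&` [set x | u01 x != u02 x]))%E ->
  solution_P Omega lambda f g T u01 u1 -> bounded_on_cylinder Omega T u1 ->
  solution_P Omega lambda f g T u02 u2 -> bounded_on_cylinder Omega T u2 ->
  forall x t, Omega x -> 0 < t < T -> u1 x t < u2 x t.
Proof.
move=> _ bO l0 T0 al hf f0 _ g0 gC2 g'0 L1 L2 _ u0 mu0 s1 b1 s2 b2 x t Ox tT.
rewrite -subr_gt0.
exact: (difference_gt0 bO l0 T0 al hf f0 g0 gC2 g'0 L1 L2 u0 s1 b1 s2 b2 Ox tT mu0).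
Qed.
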